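(* Let $(F,\partial)$ be a differential field of characteristic zero with field of constants $K$. Let $\phi\colon G\to G'$ be a morphism of linear algebraic groups over $K$, and let $\psi\colon X\to X'$ be a $G_F$-equivariant morphism from a $G_F$-torsor $X$ to a $G'_F$-torsor $X'$ (where $G$ acts on $X'$ via $\phi$). Then: (a) If $X$ is differential (i.e. equipped with the structure of a differential $G_F$-torsor), then there exists a unique differential structure on the $G'_F$-torsor $X'$ such that $\psi$ is differential. (b) If $X'$ is differential (i.e. equipped with the structure of a differential $G'_F$-torsor), $K$ is algebraically closed, and $\phi$ is surjective, then there exists a differential structure on the $G_F$-torsor $X$ such that $\psi$ is differential.
   Context: A linear algebraic group over $K$ is an affine group scheme of finite type over $K$ (smooth, as $\operatorname{char}K=0$). $F[G]:=F\otimes_K K[G]$ is a differential ring extension of $F$ in which elements of $K[G]$ are constant. A $G_F$-torsor is a non-empty affine scheme $X$ of finite type over $F$ with a right $G_F$-action such that for every $F$-algebra $R$ and all $x,y\in X(R)$ there is a unique $g\in G(R)$ with $y=x.g$. A differential structure on a $G_F$-torsor $X$ is an extension of $\partial$ from $F$ to a derivation of $F[X]$ such that the co-action $F[X]\to F[X]\otimes_F F[G]$ is a differential homomorphism (commutes with the derivations); $X$ with such a structure is a differential $G_F$-torsor. For a differential $G_F$-torsor $X$ and a differential $G'_F$-torsor $X'$, a $G_F$-equivariant morphism $\psi\colon X\to X'$ is called differential if $\psi^*\colon F[X']\to F[X]$ commutes with the derivations. *)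

(* Defs.v *)
From HB Require Import structures.
From mathcomp Require Import all_boot all_algebra.
From mathcomp Require Import generic_quotient ring_quotient.
From mathcomp Require Import boolp classical_sets.

Set Implicit Arguments.
Unset Strict Implicit.
Unset Printing Implicit Defensive.

Import GRing.Theory.
Local Open Scope ring_scope.
Local Open Scope quotient_scope.

Section TensorQuotient.
Variables (k : fieldType) (A B : comAlgType k).

Definition balanced (V : zmodType) (f : A -> B -> V) : Prop :=
  [/\ forall a a' b, f (a + a') b = f a b + f a' b,
      forall a b b', f a (b + b') = f a b + f a b' &
      forall (c : k) a b, f (c *: a) b = f a (c *: b)].

(* A list [:: (a1, b1); ...; (an, bn)] stands for the formal sum of the
   ai (x) bi; two formal sums are identified when no balanced map separates
   them, i.e. when they agree in the tensor product of A and B over k. *)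
Definition tens_eq : rel (seq (A * B)) := fun s t =>
  `[< forall (V : zmodType) (f : A -> B -> V), balanced f ->
      \sum_(p <- s) f p.1 p.2 = \sum_(p <- t) f p.1 p.2 >].

Lemma tens_eq_equiv : equiv_class_of tens_eq.
Proof.
split=> [s|s t|t s u].
- exact/asboolP.
- by apply/idP/idP=> /asboolP h; apply/asboolP=> V f /h.
- by move=> /asboolP h /asboolP h'; apply/asboolP=> V f hf; rewrite h ?h'.
Qed.

Canonical tens_eq_rel := EquivRelPack tens_eq_equiv.

Definition tens := {eq_quot tens_eq}.

HB.instance Definition _ : EqQuotient _ tens_eq tens := EqQuotient.on tens.
HB.instance Definition _ := Choice.on tens.

Definition tens_class (s : seq (A * B)) : tens := \pi_tens s.

Definition pure (a : A) (b : B) : tens := tens_class [:: (a, b)].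

(* The additive map a (x) b |-> f a b; only meaningful for balanced f. *)
Definition tens_lift (V : zmodType) (f : A -> B -> V) (t : tens) : V :=
  \sum_(p <- repr t) f p.1 p.2.

Lemma tens_classP (s t : seq (A * B)) :
  (forall (V : zmodType) (f : A -> B -> V), balanced f ->
      \sum_(p <- s) f p.1 p.2 = \sum_(p <- t) f p.1 p.2) <->
  tens_class s = tens_class t.
Proof.
split=> [h|/eqmodP /asboolP //].
by apply/eqmodP/asboolP.
Qed.

Lemma tens_classK t : tens_class (repr t) = t.
Proof. exact: reprK. Qed.

Lemma tens_lift_class (V : zmodType) (f : A -> B -> V) s : balanced f ->
  tens_lift f (tens_class s) = \sum_(p <- s) f p.1 p.2.
Proof.
move=> hf; rewrite /tens_lift.
by have /tens_classP -> := tens_classK (tens_class s).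
Qed.

Lemma tens_lift_pure (V : zmodType) (f : A -> B -> V) a b : balanced f ->
  tens_lift f (pure a b) = f a b.
Proof. by move=> hf; rewrite tens_lift_class // big_seq1. Qed.

Lemma balanced0l (V : zmodType) (f : A -> B -> V) b : balanced f -> f 0 b = 0.
Proof. by case=> h _ _; apply: (addrI (f 0 b)); rewrite -h !addr0. Qed.

Lemma balancedNl (V : zmodType) (f : A -> B -> V) a b :
  balanced f -> f (- a) b = - f a b.
Proof.
move=> hf; apply: (addrI (f a b)); case: (hf) => h _ _.
by rewrite -h !subrr (balanced0l _ hf).
Qed.

Definition tens_add (t u : tens) := tens_class (repr t ++ repr u).
Definition tens_opp (t : tens) := tens_class [seq (- p.1, p.2) | p <- repr t].
Definition tens_zero := tens_class [::].

Lemma tens_add_class s t :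
  tens_add (tens_class s) (tens_class t) = tens_class (s ++ t).
Proof.
apply/tens_classP=> V f hf; rewrite !big_cat /=.
by congr (_ + _); apply/tens_classP: V f hf; rewrite tens_classK.
Qed.

Lemma tens_addA : associative tens_add.
Proof.
move=> t u v; rewrite -(tens_classK t) -(tens_classK u) -(tens_classK v).
by rewrite !tens_add_class catA.
Qed.

Lemma tens_addC : commutative tens_add.
Proof.
move=> t u; apply/tens_classP=> V f hf.
by rewrite !big_cat /= addrC.
Qed.

Lemma tens_add0 : left_id tens_zero tens_add.
Proof. by move=> t; rewrite -(tens_classK t) tens_add_class. Qed.

Lemma tens_addN : left_inverse tens_zero tens_opp tens_add.
Proof.
move=> t; rewrite -{2}(tens_classK t) tens_add_class.
apply/tens_classP=> V f hf; rewrite big_cat big_nil big_map /= -big_split /=.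
by apply: big1 => p _; rewrite (balancedNl _ _ hf) addNr.
Qed.

HB.instance Definition _ :=
  GRing.isZmodule.Build tens tens_addA tens_addC tens_add0 tens_addN.

Lemma tens_class_sum s : tens_class s = \sum_(p <- s) pure p.1 p.2.
Proof.
elim: s => [|[a b] s IHs]; first by rewrite big_nil.
by rewrite big_cons -IHs [RHS]tens_add_class.
Qed.

Lemma tens_sum t : t = \sum_(p <- repr t) pure p.1 p.2.
Proof. by rewrite -tens_class_sum tens_classK. Qed.

Lemma pureD a b a' b' : pure a b + pure a' b' = tens_class [:: (a, b); (a', b')].
Proof. exact: tens_add_class. Qed.

Lemma pure_balanced : balanced pure.
Proof.
split=> [a a' b|a b b'|c a b]; rewrite ?pureD /pure;
  apply/tens_classP=> V f [h1 h2 h3]; rewrite !big_cons !big_nil /= !addr0.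
- exact: h1.
- exact: h2.
- exact: h3.
Qed.

Lemma tens_liftD (V : zmodType) (f : A -> B -> V) : balanced f ->
  {morph tens_lift f : t u / t + u}.
Proof.
move=> hf t u; rewrite -(tens_classK t) -(tens_classK u).
by rewrite [_ + _]tens_add_class !tens_lift_class // big_cat.
Qed.

Lemma tens_ind (P : tens -> Prop) : P 0 -> (forall a b, P (pure a b)) ->
  (forall t u, P t -> P u -> P (t + u)) -> forall t, P t.
Proof.
by move=> P0 Pp PD t; rewrite (tens_sum t); elim/big_rec: _ => // *; apply: PD.
Qed.

Lemma tens_lift0 (V : zmodType) (f : A -> B -> V) : balanced f ->
  tens_lift f 0 = 0.
Proof. by move=> hf; have := tens_lift_class [::] hf; rewrite big_nil. Qed.

Definition tens_scale (c : k) : tens -> tens :=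
  tens_lift (fun a b => pure (c *: a) b).

Lemma scale_balanced (c : k) : balanced (fun a b => pure (c *: a) b).
Proof.
case: pure_balanced => h1 h2 h3.
split=> [a a' b|a b b'|d a b].
- by rewrite scalerDr h1.
- by rewrite h2.
- by rewrite scalerA mulrC -scalerA h3.
Qed.

Lemma tens_scale_pure c a b : tens_scale c (pure a b) = pure (c *: a) b.
Proof. exact: (tens_lift_pure _ _ (scale_balanced c)). Qed.

Lemma tens_scaleDr : right_distributive tens_scale +%R.
Proof. by move=> c; apply/tens_liftD/scale_balanced. Qed.

Lemma tens_scale0 c : tens_scale c 0 = 0.
Proof. exact/tens_lift0/scale_balanced. Qed.

Lemma tens_scaleA c d t : tens_scale c (tens_scale d t) = tens_scale (c * d) t.
Proof.
elim/tens_ind: t => [|a b|t u IHt IHu].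
- by rewrite !tens_scale0.
- by rewrite !tens_scale_pure scalerA.
- by rewrite !tens_scaleDr IHt IHu.
Qed.

Lemma tens_scale1 : left_id 1 tens_scale.
Proof.
move=> t; rewrite [RHS]tens_sum.
by apply: eq_bigr => p _; rewrite scale1r.
Qed.

Lemma tens_scaleDl t : {morph tens_scale^~ t : c d / c + d}.
Proof.
move=> c d; rewrite -big_split; apply: eq_bigr => p _ /=.
by rewrite scalerDl; case: pure_balanced => ->.
Qed.

HB.instance Definition _ := GRing.Zmodule_isLmodule.Build k tens
  tens_scaleA tens_scale1 tens_scaleDr tens_scaleDl.

Definition tens_mul (t u : tens) : tens :=
  tens_lift (fun a b => tens_lift (fun a' b' => pure (a * a') (b * b')) u) t.

Lemma mul_balanced_in a b :
  balanced (fun a' b' => pure (a * a') (b * b')).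
Proof.
case: pure_balanced => h1 h2 h3; split=> *.
- by rewrite mulrDr h1.
- by rewrite mulrDr h2.
- by rewrite -!scalerAr h3.
Qed.

Lemma mul_balanced_out u :
  balanced (fun a b => tens_lift (fun a' b' => pure (a * a') (b * b')) u).
Proof.
case: pure_balanced => h1 h2 h3; split=> *.
- by rewrite -big_split; apply: eq_bigr => p _; rewrite mulrDl h1.
- by rewrite -big_split; apply: eq_bigr => p _; rewrite mulrDl h2.
- by apply: eq_bigr => p _; rewrite -!scalerAl h3.
Qed.

Lemma tens_mul_pure a b a' b' :
  tens_mul (pure a b) (pure a' b') = pure (a * a') (b * b').
Proof.
rewrite /tens_mul (tens_lift_pure _ _ (mul_balanced_out _)).
by rewrite (tens_lift_pure _ _ (mul_balanced_in _ _)).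
Qed.

Lemma tens_mulDl : left_distributive tens_mul +%R.
Proof. by move=> t u v; apply/tens_liftD/mul_balanced_out. Qed.

Lemma tens_mulDr : right_distributive tens_mul +%R.
Proof.
move=> t u v; rewrite -big_split; apply: eq_bigr => p _ /=.
exact/tens_liftD/mul_balanced_in.
Qed.

Lemma tens_mul0l t : tens_mul 0 t = 0.
Proof. exact/tens_lift0/mul_balanced_out. Qed.

Lemma tens_mul0r t : tens_mul t 0 = 0.
Proof. by apply: big1 => p _; apply/tens_lift0/mul_balanced_in. Qed.

Lemma tens_mulC : commutative tens_mul.
Proof.
move=> t u; elim/tens_ind: t => [|a b|t t' IHt IHt'].
- by rewrite tens_mul0l tens_mul0r.
- elim/tens_ind: u => [|a' b'|u u' IHu IHu'].
  + by rewrite tens_mul0l tens_mul0r.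
  + by rewrite !tens_mul_pure mulrC [b * _]mulrC.
  + by rewrite tens_mulDr IHu IHu' tens_mulDl.
- by rewrite tens_mulDl IHt IHt' tens_mulDr.
Qed.

Lemma tens_mulA : associative tens_mul.
Proof.
move=> t u v; elim/tens_ind: t => [|a b|t t' IHt IHt'].
- by rewrite !tens_mul0l.
- elim/tens_ind: u => [|a' b'|u u' IHu IHu'].
  + by rewrite tens_mul0l tens_mul0r tens_mul0l.
  + elim/tens_ind: v => [|a'' b''|v v' IHv IHv'].
    * by rewrite !tens_mul0r.
    * by rewrite !tens_mul_pure !mulrA.
    * by rewrite !tens_mulDr IHv IHv'.
  + by rewrite tens_mulDl !tens_mulDr tens_mulDl IHu IHu'.
- by rewrite !tens_mulDl IHt IHt'.
Qed.

Lemma tens_mul1 : left_id (pure 1 1) tens_mul.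
Proof.
move=> t; elim/tens_ind: t => [|a b|t u IHt IHu].
- by rewrite tens_mul0r.
- by rewrite tens_mul_pure !mul1r.
- by rewrite tens_mulDr IHt IHu.
Qed.

(* A k-linear retraction of k -> B, from a maximal linear subset of B that
   does not contain 1. *)
Lemma unit_retraction : exists2 l : B -> k,
  l 1 = 1 & forall c x y, l (c *: x + y) = c * l x + l y.
Proof.
pose lin (S : set B) := forall (c : k) x y, S x -> S y -> S (c *: x + y).
have [F FP Ftot|S [[S1 Slin] Smax]] :=
    @Zorn_bigcup B [set S : set B | ~ S 1 /\ lin S].
  split=> [[S FS S1]|c x y [S FS Sx] [S' FS' S'y]]; first by case: (FP _ FS).
  case: (Ftot _ _ FS FS') => sub.
    by exists S' => //; have [_ h] := FP _ FS'; apply: h => //; apply: sub.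
  by exists S => //; have [_ h] := FP _ FS; apply: h => //; apply: sub.
pose W : set B := fun x => x = 0 \/ S x.
have W0 : W 0 by left.
have Wlin c x y : W x -> W y -> W (c *: x + y).
  case=> [->|Sx] [->|Sy]; first by left; rewrite scaler0 addr0.
  - by right; rewrite scaler0 add0r.
  - right; have := Slin (c - 1) x x Sx Sx.
    by rewrite scalerBl scale1r subrK addr0.
  - by right; apply: Slin.
have WZ c x : W x -> W (c *: x) by move=> Wx; rewrite -[_ *: _]addr0; apply: Wlin.
have W1 : ~ W 1 by case=> // /eqP; rewrite oner_eq0.
have dec x : exists c : k, W (x - c *: 1).
  case: (pselect (W x)) => [Wx|nWx]; first by exists 0; rewrite scale0r subr0.
  pose S' : set B := fun y => exists2 c : k, True & W (y - c *: x).
  have S'lin : lin S'.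
    move=> c y z [d _ Wy] [e _ Wz]; exists (c * d + e) => //.
    rewrite scalerDl opprD addrACA -scalerA -scalerBr; exact: Wlin.
  have SS' : (S `<` S')%classic.
    split=> [y Sy|sub]; first by exists 0 => //; rewrite scale0r subr0; right.
    by apply: nWx; right; apply: sub; exists 1 => //; rewrite scale1r subrr.
  have [[c _ Wc]|nS'1] := pselect (S' 1); last by case: (Smax _ SS').
  have c0 : c != 0 by apply/eqP=> c0; apply: W1; rewrite c0 scale0r subr0 in Wc.
  exists c^-1; have := WZ (- c^-1) _ Wc.
  by rewrite scalerBr scalerA mulNr mulVf // scaleN1r opprK scaleNr addrC.
have uniq x c d : W (x - c *: 1) -> W (x - d *: 1) -> c = d.
  move=> Wc Wd; apply/eqP/negPn/negP => cd; apply: W1.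
  have := Wlin (-1) _ _ Wc Wd; rewrite scaleN1r opprB addrA subrK.
  rewrite -scalerBl => /(WZ (c - d)^-1).
  by rewrite scalerA mulVf ?subr_eq0 // scale1r.
exists (fun x => sval (cid (dec x))) => [|c x y].
- case: cid => c /= Wc; apply: (uniq 1) => //.
  by rewrite scale1r subrr.
- case: cid => d /= Wd; case: cid => e /= We; case: cid => e' /= We'.
  apply: uniq Wd _; rewrite scalerDl opprD addrACA -scalerA -scalerBr.
  exact: Wlin.
Qed.

Lemma tens_one_neq0 : pure 1 1 != 0.
Proof.
have [l l1 llin] := unit_retraction.
have lD x y : l (x + y) = l x + l y.
  by have := llin 1 x y; rewrite scale1r mul1r.
have l0 : l 0 = 0 by apply: (addrI (l 0)); rewrite -lD !addr0.
have lZ c x : l (c *: x) = c * l x by have := llin c x 0; rewrite !addr0 l0 addr0.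
have hf : balanced (fun (a : A) b => l b *: a).
  split=> *; first by rewrite scalerDr.
    by rewrite lD scalerDl.
  by rewrite lZ scalerA mulrC.
apply/eqP => /(congr1 (tens_lift (fun (a : A) b => l b *: a))).
rewrite tens_lift_pure // tens_lift0 // l1 scale1r => /eqP.
by rewrite oner_eq0.
Qed.

HB.instance Definition _ := GRing.Zmodule_isComNzRing.Build tens
  tens_mulA tens_mulC tens_mul1 tens_mulDl tens_one_neq0.

Lemma tens_scaleAl (c : k) (t u : tens) : c *: (t * u) = (c *: t) * u.
Proof.
elim/tens_ind: t => [|a b|t t' IHt IHt'].
- by rewrite mul0r !scaler0 mul0r.
- elim/tens_ind: u => [|a' b'|u u' IHu IHu'].
  + by rewrite !mulr0 scaler0.
  + rewrite [pure a b * _]tens_mul_pure [c *: pure a b]tens_scale_pure.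
    by rewrite [LHS]tens_scale_pure [RHS]tens_mul_pure scalerAl.
  + by rewrite !mulrDr scalerDr IHu IHu'.
- by rewrite mulrDl !scalerDr mulrDl IHt IHt'.
Qed.

HB.instance Definition _ := GRing.Lmodule_isLalgebra.Build k tens tens_scaleAl.
HB.instance Definition _ := GRing.Lalgebra_isComAlgebra.Build k tens.

Lemma pureM a b a' b' : pure a b * pure a' b' = pure (a * a') (b * b').
Proof. exact: tens_mul_pure. Qed.

Lemma pureZl c a b : c *: pure a b = pure (c *: a) b.
Proof. exact: tens_scale_pure. Qed.

End TensorQuotient.

Section TensorPairing.
Variables (k : fieldType) (A B R : comAlgType k).
Variables (f : {lrmorphism A -> R}) (g : {lrmorphism B -> R}).

Definition tens_pair : tens A B -> R := tens_lift (fun a b => f a * g b).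

Lemma tens_pair_balanced : balanced (fun a b => f a * g b).
Proof.
split=> *; first by rewrite rmorphD mulrDl.
  by rewrite rmorphD mulrDr.
by rewrite !linearZ -scalerAl -scalerAr.
Qed.

Lemma tens_pair_pure a b : tens_pair (pure a b) = f a * g b.
Proof. exact: (tens_lift_pure _ _ tens_pair_balanced). Qed.

Lemma tens_pair_nmod : nmod_morphism tens_pair.
Proof.
split; first exact/tens_lift0/tens_pair_balanced.
exact/tens_liftD/tens_pair_balanced.
Qed.

HB.instance Definition _ :=
  GRing.isNmodMorphism.Build (tens A B) R tens_pair tens_pair_nmod.

Lemma tens_pair_monoid : monoid_morphism tens_pair.
Proof.
split=> [|t u]; first by rewrite tens_pair_pure !rmorph1 mulr1.
elim/tens_ind: t => [|a b|t t' IHt IHt'].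
- by rewrite mul0r raddf0 mul0r.
- elim/tens_ind: u => [|a' b'|u u' IHu IHu'].
  + by rewrite mulr0 raddf0 mulr0.
  + by rewrite pureM !tens_pair_pure !rmorphM mulrACA.
  + by rewrite mulrDr !raddfD /= mulrDr IHu IHu'.
- by rewrite mulrDl !raddfD /= mulrDl IHt IHt'.
Qed.

HB.instance Definition _ :=
  GRing.isMonoidMorphism.Build (tens A B) R tens_pair tens_pair_monoid.

Lemma tens_pair_scalable : scalable tens_pair.
Proof.
move=> c t; elim/tens_ind: t => [|a b|t u IHt IHu].
- by rewrite scaler0 raddf0 scaler0.
- by rewrite pureZl !tens_pair_pure linearZ scalerAl.
- by rewrite scalerDr !raddfD /= IHt IHu.
Qed.

HB.instance Definition _ :=
  GRing.isScalable.Build k (tens A B) R *:%R tens_pair tens_pair_scalable.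

End TensorPairing.

Definition fin_gen_alg (k : fieldType) (A : comAlgType k) : Prop :=
  exists s : seq A, forall S : {pred A},
    GRing.subalg_closed S -> {subset s <= S} -> forall x, x \in S.

Section Points.
Variables (k : fieldType) (A R : comAlgType k).

Definition scalar_point (counit : {lrmorphism A -> k^o}) (a : A) : R :=
  (counit a)%:A.

Variable counit : {lrmorphism A -> k^o}.

Lemma scalar_point_zmod : zmod_morphism (scalar_point counit).
Proof. by move=> a b; rewrite /scalar_point raddfB scalerBl. Qed.

HB.instance Definition _ :=
  GRing.isZmodMorphism.Build A R (scalar_point counit) scalar_point_zmod.

Lemma scalar_point_monoid : monoid_morphism (scalar_point counit).
Proof.
split=> [|a b]; first by rewrite /scalar_point rmorph1 scale1r.
by rewrite /scalar_point rmorphM -scalerAl mul1r scalerA.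
Qed.

HB.instance Definition _ :=
  GRing.isMonoidMorphism.Build A R (scalar_point counit) scalar_point_monoid.

Lemma scalar_point_scalable : scalable (scalar_point counit).
Proof. by move=> c a; rewrite /scalar_point linearZ /= scalerA. Qed.

HB.instance Definition _ :=
  GRing.isScalable.Build k A R *:%R (scalar_point counit) scalar_point_scalable.

End Points.

(* Affine group schemes of finite type over k, by their Hopf algebras k[G].
   An R-point of G is a k-algebra morphism k[G] -> R; the Hopf algebra axioms
   are stated as the group axioms on R-points, for all k-algebras R. *)
Record groupData (k : fieldType) := GroupData {
  gcoord : comAlgType k;
  gcomul : {lrmorphism gcoord -> tens gcoord gcoord};
  gcounit : {lrmorphism gcoord -> k^o};
  gantipode : {lrmorphism gcoord -> gcoord}
}.

Section GroupPoints.
Variables (k : fieldType) (G : groupData k) (R : comAlgType k).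

Definition gpoint : Type := {lrmorphism gcoord G -> R}.

Definition gmul (g h : gpoint) : gpoint := tens_pair g h \o gcomul G.
Definition gone : gpoint := scalar_point R (gcounit G).
Definition ginv (g : gpoint) : gpoint := g \o gantipode G.

End GroupPoints.

Record linAlgGroup (k : fieldType) := LinAlgGroup {
  gdata :> groupData k;
  gfin : fin_gen_alg (gcoord gdata);
  gmulA : forall (R : comAlgType k) (g h l : gpoint gdata R),
    gmul g (gmul h l) =1 gmul (gmul g h) l;
  gmul1g : forall (R : comAlgType k) (g : gpoint gdata R),
    gmul (gone gdata R) g =1 g;
  gmulg1 : forall (R : comAlgType k) (g : gpoint gdata R),
    gmul g (gone gdata R) =1 g;
  gmulVg : forall (R : comAlgType k) (g : gpoint gdata R),
    gmul (ginv g) g =1 gone gdata R;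
  gmulgV : forall (R : comAlgType k) (g : gpoint gdata R),
    gmul g (ginv g) =1 gone gdata R
}.

(* A morphism G -> G', given contravariantly by k[G'] -> k[G]. *)
Record groupMorphism (k : fieldType) (G G' : linAlgGroup k) := GroupMorphism {
  gcomorph :> {lrmorphism gcoord G' -> gcoord G};
  gcomorphM : forall (R : comAlgType k) (g h : gpoint G R),
    (gmul g h \o gcomorph : gpoint G' R) =1
    gmul (g \o gcomorph : gpoint G' R) (h \o gcomorph : gpoint G' R)
}.

Definition prime_ideal (R : comNzRingType) (P : {pred R}) : Prop :=
  idealr_closed P /\ prime_idealr_closed P.

(* Surjectivity of the underlying map Spec k[G] -> Spec k[G']. *)
Definition surjective_morphism (k : fieldType) (G G' : linAlgGroup k)
    (phi : groupMorphism G G') : Prop :=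
  forall Q : {pred gcoord G'}, prime_ideal Q ->
  exists2 P : {pred gcoord G}, prime_ideal P &
    forall a, (a \in Q) = (phi a \in P).

Definition derivation (R : comNzRingType) (d : R -> R) : Prop :=
  {morph d : x y / x + y} /\ forall x y, d (x * y) = d x * y + x * d y.

HB.mixin Record Field_isDifferential F of GRing.Field F := {
  der : F -> F;
  der_derivation : derivation der
}.

#[short(type="diffFieldType")]
HB.structure Definition DiffField := {F of GRing.Field F & Field_isDifferential F}.

Section Constants.
Variable F : diffFieldType.

Definition is_constant : {pred F} := [pred x | der x == 0].

Lemma is_constantE x : (x \in is_constant) = (der x == 0).
Proof. by []. Qed.

Lemma derD (x y : F) : der (x + y) = der x + der y.
Proof. by case: (@der_derivation F). Qed.

Lemma derM (x y : F) : der (x * y) = der x * y + x * der y.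
Proof. by case: (@der_derivation F). Qed.

Lemma der0 : der (0 : F) = 0.
Proof. by apply: (addrI (der 0)); rewrite -derD !addr0. Qed.

Lemma derN (x : F) : der (- x) = - der x.
Proof. by apply: (addrI (der x)); rewrite -derD !subrr der0. Qed.

Lemma der1 : der (1 : F) = 0.
Proof.
by apply: (addrI (der 1)); rewrite -{3}[1]mulr1 derM mulr1 mul1r addr0.
Qed.

Lemma constant_divring : divring_closed is_constant.
Proof.
split=> [|x y|x y]; rewrite !is_constantE.
- by rewrite der1.
- by move=> /eqP dx /eqP dy; rewrite derD derN dx dy subr0.
- move=> /eqP dx /eqP dy; have [->|y0] := eqVneq y 0.
    by rewrite invr0 mulr0 der0.
  have dV : der y^-1 = 0.
    apply: (mulfI y0); have := derM y y^-1.
    by rewrite mulfV // der1 dy mul0r add0r mulr0.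
  by rewrite derM dx dV mul0r mulr0 addr0.
Qed.

HB.instance Definition _ :=
  GRing.isDivringClosed.Build F is_constant constant_divring.

Record constants := Constant { cval : F; _ : cval \in is_constant }.

HB.instance Definition _ := [isSub for cval].
HB.instance Definition _ := [Choice of constants by <:].
HB.instance Definition _ := [SubChoice_isSubIntegralDomain of constants by <:].
HB.instance Definition _ := [SubIntegralDomain_isSubField of constants by <:].

End Constants.

Section Restriction.
Variables (F : diffFieldType) (R : comAlgType F).

(* R regarded as an algebra over the field of constants K of F. *)
Definition restr : Type := R.

HB.instance Definition _ := GRing.ComNzRing.on restr.

Definition restr_scale (c : constants F) (x : restr) : restr :=
  (val c : F) *: (x : R).

Lemma restr_scaleA c d x : restr_scale c (restr_scale d x) = restr_scale (c * d) x.
Proof. exact: scalerA. Qed.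
Lemma restr_scale1 : left_id 1 restr_scale.
Proof. exact: scale1r. Qed.
Lemma restr_scaleDr : right_distributive restr_scale +%R.
Proof. by move=> c x y; apply: scalerDr. Qed.
Lemma restr_scaleDl x : {morph restr_scale^~ x : c d / c + d}.
Proof. by move=> c d; apply: scalerDl. Qed.

HB.instance Definition _ := GRing.Zmodule_isLmodule.Build (constants F) restr
  restr_scaleA restr_scale1 restr_scaleDr restr_scaleDl.

Lemma restr_scaleAl (c : constants F) (x y : restr) : c *: (x * y) = (c *: x) * y.
Proof. exact: (@scalerAl F R). Qed.

HB.instance Definition _ :=
  GRing.Lmodule_isLalgebra.Build (constants F) restr restr_scaleAl.
HB.instance Definition _ := GRing.Lalgebra_isComAlgebra.Build (constants F) restr.

End Restriction.

Section BaseChange.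
Variables (F : diffFieldType) (A : comAlgType (constants F)).

(* F (x)_K A as an F-algebra. *)
Definition baseChange : Type := tens (restr F^o) A.

HB.instance Definition _ := GRing.ComNzRing.on baseChange.

Definition bpure (c : F) (a : A) : baseChange :=
  pure (c : restr F^o) a.

Definition base_scale (c : F) (t : baseChange) : baseChange := bpure c 1 * t.

Lemma bpureM c a d b : bpure c a * bpure d b = bpure (c * d) (a * b).
Proof. exact: (@pureM _ (restr F^o)). Qed.

Lemma base_scaleA c d t : base_scale c (base_scale d t) = base_scale (c * d) t.
Proof. by rewrite /base_scale mulrA bpureM mulr1. Qed.
Lemma base_scale1 : left_id 1 base_scale.
Proof. exact: mul1r. Qed.
Lemma base_scaleDr : right_distributive base_scale +%R.
Proof. by move=> c x y; apply: mulrDr. Qed.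
Lemma base_scaleDl t : {morph base_scale^~ t : c d / c + d}.
Proof.
move=> c d; rewrite /base_scale -mulrDl; congr (_ * _).
by case: (@pure_balanced _ (restr F^o) A) => h _ _; apply: h.
Qed.

HB.instance Definition _ := GRing.Zmodule_isLmodule.Build F baseChange
  base_scaleA base_scale1 base_scaleDr base_scaleDl.

Lemma base_scaleAl (c : F) (x y : baseChange) : c *: (x * y) = (c *: x) * y.
Proof. exact: mulrA. Qed.

HB.instance Definition _ := GRing.Lmodule_isLalgebra.Build F baseChange base_scaleAl.
HB.instance Definition _ := GRing.Lalgebra_isComAlgebra.Build F baseChange.

Lemma bpureZ (c d : F) a : c *: bpure d a = bpure (c * d) a.
Proof. by rewrite [LHS]bpureM mul1r. Qed.

Lemma baseChange_ind (P : baseChange -> Prop) : P 0 ->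
  (forall c a, P (bpure c a)) ->
  (forall t u, P t -> P u -> P (t + u)) -> forall t, P t.
Proof. exact: (@tens_ind _ (restr F^o) A P). Qed.

Variables (R : comAlgType F) (g : {lrmorphism A -> restr R}).

(* The F-algebra morphism F (x)_K A -> R extending g. *)
Definition point_ext (t : baseChange) : R :=
  @tens_lift _ (restr F^o) A R (fun c a => (c : F) *: (g a : R)) t.

Lemma point_ext_balanced :
  @balanced _ (restr F^o) A R (fun c a => (c : F) *: (g a : R)).
Proof.
split=> [c d a|c a b|c d a].
- by rewrite scalerDl.
- by rewrite rmorphD scalerDr.
- rewrite linearZ /=.
  change (((val c : F) * (d : F)) *: (g a : R) = (d : F) *: ((val c : F) *: (g a : R))).
  by rewrite scalerA mulrC.
Qed.

Lemma point_ext_pure c a : point_ext (bpure c a) = c *: (g a : R).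
Proof. exact: (tens_lift_pure _ _ point_ext_balanced). Qed.

Lemma point_ext_nmod : nmod_morphism point_ext.
Proof.
split; first exact/tens_lift0/point_ext_balanced.
exact/tens_liftD/point_ext_balanced.
Qed.

HB.instance Definition _ :=
  GRing.isNmodMorphism.Build baseChange R point_ext point_ext_nmod.

Lemma point_ext_monoid : monoid_morphism point_ext.
Proof.
split=> [|t u].
  by rewrite (point_ext_pure 1 1) rmorph1 scale1r.
elim/baseChange_ind: t => [|c a|t t' IHt IHt'].
- by rewrite mul0r raddf0 mul0r.
- elim/baseChange_ind: u => [|d b|u u' IHu IHu'].
  + by rewrite mulr0 raddf0 mulr0.
  + rewrite bpureM !point_ext_pure rmorphM.
    by rewrite -scalerAl -[_ * (d *: _)]scalerAr scalerA.
  + by rewrite mulrDr !raddfD /= mulrDr IHu IHu'.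
- by rewrite mulrDl !raddfD /= mulrDl IHt IHt'.
Qed.

HB.instance Definition _ :=
  GRing.isMonoidMorphism.Build baseChange R point_ext point_ext_monoid.

Lemma point_ext_scalable : scalable point_ext.
Proof.
move=> c t; rewrite [c *: t]/(bpure c 1 * t) rmorphM /=.
by rewrite point_ext_pure rmorph1 -scalerAl mul1r.
Qed.

HB.instance Definition _ :=
  GRing.isScalable.Build F baseChange R *:%R point_ext point_ext_scalable.

End BaseChange.

Section TensorDerivation.
Variables (k : fieldType) (A B : comAlgType k).

(* d1 (x) 1 + 1 (x) d2, for additive d1 and d2 extending one and the same
   derivation d0 of k. *)
Definition tens_der (d1 : A -> A) (d2 : B -> B) : tens A B -> tens A B :=
  tens_lift (fun a b => pure (d1 a) b + pure a (d2 b)).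

Definition extends_der (d0 : k -> k) (C : comAlgType k) (d : C -> C) : Prop :=
  {morph d : x y / x + y} /\ forall c x, d (c *: x) = d0 c *: x + c *: d x.

Lemma tens_der_balanced (d0 : k -> k) (d1 : A -> A) (d2 : B -> B) :
  extends_der d0 d1 -> extends_der d0 d2 ->
  balanced (fun a b => pure (d1 a) b + pure a (d2 b)).
Proof.
case=> [D1 Z1] [D2 Z2]; have [h1 h2 h3] := @pure_balanced _ A B.
split=> [a a' b|a b b'|c a b].
- by rewrite D1 !h1 addrACA.
- by rewrite D2 !h2 addrACA.
- by rewrite Z1 Z2 h1 h2 !h3 [RHS]addrCA addrA.
Qed.

Lemma tens_der_pure (d0 : k -> k) (d1 : A -> A) (d2 : B -> B) a b :
  extends_der d0 d1 -> extends_der d0 d2 ->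
  tens_der d1 d2 (pure a b) = pure (d1 a) b + pure a (d2 b).
Proof.
by move=> e1 e2; apply: (tens_lift_pure _ _ (tens_der_balanced e1 e2)).
Qed.

End TensorDerivation.

(* The derivation of F (x)_K A that extends that of F and kills A. *)
Definition base_der (F : diffFieldType) (A : comAlgType (constants F))
    (t : baseChange A) : baseChange A :=
  @tens_der _ (restr F^o) A der (fun=> 0) t.

Section BaseDer.
Variables (F : diffFieldType) (A : comAlgType (constants F)).

Lemma der_const : extends_der (fun=> 0) (der : restr F^o -> restr F^o).
Proof.
split=> [x y|e x]; first exact: derD.
rewrite scale0r add0r.
change (der ((val e : F) * (x : F)) = (val e : F) * der (x : F)).
by have /eqP := valP e; rewrite derM => ->; rewrite mul0r add0r.
Qed.

Lemma zero_const : extends_der (fun=> 0) (fun=> 0 : A).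
Proof.
split=> [x y|e x]; first by rewrite addr0.
by rewrite scaler0 scale0r addr0.
Qed.

Lemma base_der_pure (c : F) (a : A) : base_der (bpure c a) = bpure (der c) a.
Proof.
have [h1 h2 h3] := @pure_balanced _ (restr F^o) A.
rewrite /base_der /bpure (tens_der_pure _ _ der_const zero_const).
have := h2 (c : restr F^o) 0 0; rewrite addr0 => /eqP.
by rewrite addrC -subr_eq subrr => /eqP <-; rewrite addr0.
Qed.

Lemma base_derD : {morph @base_der F A : t u / t + u}.
Proof. exact: (tens_liftD (tens_der_balanced der_const zero_const)). Qed.

Lemma base_der_extends : extends_der der (@base_der F A).
Proof.
split; first exact: base_derD.
have [h1 h2 h3] := @pure_balanced _ (restr F^o) A.
move=> c t; elim/baseChange_ind: t => [|d a|t u IHt IHu].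
- have b0 : base_der 0 = 0 :> baseChange A.
    by apply: (addrI (base_der 0)); rewrite -base_derD !addr0.
  by rewrite !scaler0 b0 scaler0 addr0.
- by rewrite bpureZ !base_der_pure !bpureZ derM; apply: h1.
- by rewrite scalerDr !base_derD IHt IHu !scalerDr addrACA.
Qed.

End BaseDer.

(* A scheme X over F with a co-action F[X] -> F[X] (x)_F F[G]; X is non-empty
   since F[X], like every comAlgType, is a nonzero ring. *)
Record actionData (F : diffFieldType) (G : linAlgGroup (constants F)) :=
  ActionData {
    tcoord : comAlgType F;
    tcoact : {lrmorphism tcoord -> tens tcoord (baseChange (gcoord G))}
  }.

Section TorsorPoints.
Variables (F : diffFieldType) (G : linAlgGroup (constants F)).
Variables (X : actionData G) (R : comAlgType F).

Definition tpoint : Type := {lrmorphism tcoord X -> R}.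

(* x.g, for x in X(R) and g in G(R). *)
Definition tact (x : tpoint) (g : gpoint G (restr R)) : tpoint :=
  tens_pair x (point_ext g) \o tcoact X.

End TorsorPoints.

Record torsor (F : diffFieldType) (G : linAlgGroup (constants F)) := Torsor {
  tdata :> actionData G;
  tfin : fin_gen_alg (tcoord tdata);
  tact1 : forall (R : comAlgType F) (x : tpoint tdata R),
    tact x (gone G (restr R)) =1 x;
  tactM : forall (R : comAlgType F) (x : tpoint tdata R)
      (g h : gpoint G (restr R)),
    tact (tact x g) h =1 tact x (gmul g h);
  tact_simply_transitive : forall (R : comAlgType F) (x y : tpoint tdata R),
    exists g : gpoint G (restr R),
      y =1 tact x g /\ forall h : gpoint G (restr R), y =1 tact x h -> g =1 h
}.

Definition equivariant (F : diffFieldType) (G G' : linAlgGroup (constants F))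
    (phi : groupMorphism G G') (X : torsor G) (X' : torsor G')
    (psi : {lrmorphism tcoord X' -> tcoord X}) : Prop :=
  forall (R : comAlgType F) (x : tpoint X R) (g : gpoint G (restr R)),
    (tact x g \o psi : tpoint X' R) =1
    tact (x \o psi : tpoint X' R) (g \o phi : gpoint G' (restr R)).

Definition differential_structure (F : diffFieldType)
    (G : linAlgGroup (constants F)) (X : torsor G)
    (d : tcoord X -> tcoord X) : Prop :=
  [/\ derivation d,
      forall c : F, d c%:A = (der c)%:A &
      forall x, tcoact X (d x) =
        tens_der d (@base_der F (gcoord G)) (tcoact X x)].

Definition differential_morphism (F : diffFieldType)
    (G G' : linAlgGroup (constants F)) (X : torsor G) (X' : torsor G')
    (psi : {lrmorphism tcoord X' -> tcoord X})
    (d : tcoord X -> tcoord X) (d' : tcoord X' -> tcoord X') : Prop :=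
  forall x, psi (d' x) = d (psi x).

(* Main.v *)
(** A derivation d on F[X] extending the derivation of F is the same as a point
    (id, d) of X over the dual numbers R[eps], R = F[X], on which c in F acts as
    c + der(c) eps; the co-action is differential exactly when the induced lift
    X(R) -> X(R[eps]), y |-> (y, y o d), commutes with G(R), for all R.

    Hence any single point x~ of X(R[eps]), over any F-algebra R, yields a
    differential structure: over R (x) F[X] the universal point is x.g for a
    unique g, where x is the reduction of x~, and the second component of x~.g is
    an equivariant derivation F[X] -> R (x) F[X], which an F-linear retraction
    R -> F turns into a derivation of F[X].  It is compatible with psi as soon as
    x~ is.  Part (a) is the case x~ = psi o (id, d) of X'.

    For part (b), the elements of F[X'] all of whose iterated derivatives vanish
    at some field-valued point form a prime ideal stable under d', because the
    characteristic is 0.  Its residue field has an extension M over which this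
    point lifts to X, because X x X' is a trivial torsor over X and phi is
    surjective; and the derivation that d' induces inside M extends to M, again
    because the characteristic is 0.  This gives x~. *)
Require Import Defs.
From HB Require Import structures.
From mathcomp Require Import all_boot all_algebra.
From mathcomp Require Import generic_quotient ring_quotient fraction.
From mathcomp Require Import boolp classical_sets.

Set Implicit Arguments.
Unset Strict Implicit.
Unset Printing Implicit Defensive.

Import GRing.Theory.
Local Open Scope ring_scope.

(** * Dual numbers *)

Section DualNumbers.
Variable R : comNzRingType.

(* The pair (a, b) stands for a + b eps, with eps^2 = 0. *)
Definition dual_numbers : Type := (R * R)%type.

HB.instance Definition _ := GRing.Zmodule.on dual_numbers.

Implicit Types u v w : dual_numbers.

Definition dual_mul u v : dual_numbers := (u.1 * v.1, u.1 * v.2 + u.2 * v.1).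

Lemma dual_mulA : associative dual_mul.
Proof.
move=> u v w; rewrite /dual_mul /= mulrA; congr pair.
by rewrite mulrDr mulrDl !mulrA addrA.
Qed.

Lemma dual_mulC : commutative dual_mul.
Proof.
move=> u v; rewrite /dual_mul mulrC; congr pair.
by rewrite addrC [u.2 * _]mulrC [u.1 * _]mulrC.
Qed.

Lemma dual_mul1 : left_id ((1, 0) : dual_numbers) dual_mul.
Proof. by case=> a b; rewrite /dual_mul /= !mul1r mul0r addr0. Qed.

Lemma dual_mulDl : left_distributive dual_mul +%R.
Proof.
move=> u v w; rewrite /dual_mul /= mulrDl; congr pair => /=.
by rewrite !mulrDl addrACA.
Qed.

Lemma dual_one_neq0 : ((1, 0) : dual_numbers) != 0.
Proof. by apply/eqP => -[/eqP]; rewrite oner_eq0. Qed.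

HB.instance Definition _ := GRing.Zmodule_isComNzRing.Build dual_numbers
  dual_mulA dual_mulC dual_mul1 dual_mulDl dual_one_neq0.

End DualNumbers.

Section DualAlgebra.
Variables (F : diffFieldType) (R : comAlgType F).

(* The dual numbers over R, with F acting through c |-> c + (der c) eps. *)
Definition dual : Type := dual_numbers R.

HB.instance Definition _ := GRing.ComNzRing.on dual.

Implicit Types u v : dual.

Definition dual_scale (c : F) u : dual :=
  (c *: u.1, c *: u.2 + der c *: u.1).

Lemma dual_scaleA c d u : dual_scale c (dual_scale d u) = dual_scale (c * d) u.
Proof.
rewrite /dual_scale /= scalerA; congr pair.
by rewrite scalerDr derM scalerDl !scalerA -!addrA [der c * d]mulrC
           [d * der c]mulrC [_ *: u.1 + (_ *: u.1)]addrC.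
Qed.
Lemma dual_scale1 : left_id 1 dual_scale.
Proof. by case=> a b; rewrite /dual_scale /= !scale1r der1 scale0r addr0. Qed.
Lemma dual_scaleDr : right_distributive dual_scale +%R.
Proof.
move=> c u v; rewrite /dual_scale /= scalerDr; congr pair => /=.
by rewrite !scalerDr addrACA.
Qed.
Lemma dual_scaleDl u : {morph dual_scale^~ u : c d / c + d}.
Proof.
move=> c d; rewrite /dual_scale /= scalerDl; congr pair => /=.
by rewrite derD !scalerDl addrACA.
Qed.

HB.instance Definition _ := GRing.Zmodule_isLmodule.Build F dual
  dual_scaleA dual_scale1 dual_scaleDr dual_scaleDl.

Lemma dual_scaleAl (c : F) u v : c *: (u * v) = (c *: u) * v.
Proof.
congr pair => /=; rewrite -!scalerAl //.
by rewrite scalerDr mulrDl -!scalerAl addrA.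
Qed.

HB.instance Definition _ := GRing.Lmodule_isLalgebra.Build F dual dual_scaleAl.
HB.instance Definition _ := GRing.Lalgebra_isComAlgebra.Build F dual.

Definition dual_re (u : dual) : R := u.1.

Lemma dual_re_zmod : zmod_morphism dual_re. Proof. by []. Qed.
Lemma dual_re_monoid : monoid_morphism dual_re. Proof. by []. Qed.
Lemma dual_re_scalable : scalable dual_re. Proof. by []. Qed.
HB.instance Definition _ := GRing.isZmodMorphism.Build dual R dual_re dual_re_zmod.
HB.instance Definition _ :=
  GRing.isMonoidMorphism.Build dual R dual_re dual_re_monoid.
HB.instance Definition _ :=
  GRing.isScalable.Build F dual R *:%R dual_re dual_re_scalable.

Lemma dual_re_sum I (r : seq I) (f : I -> dual) :
  (\sum_(i <- r) f i).1 = \sum_(i <- r) (f i).1.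
Proof. exact: (raddf_sum dual_re). Qed.

Lemma dual_im_sum I (r : seq I) (f : I -> dual) :
  (\sum_(i <- r) f i).2 = \sum_(i <- r) (f i).2.
Proof. by elim/big_ind2: _ => // u a v b <- <-. Qed.

End DualAlgebra.

Section DualPoint.
Variables (F : diffFieldType) (A R : comAlgType F).
Variables (x : {lrmorphism A -> R}) (D : A -> R).

Definition derivation_over : Prop :=
  [/\ {morph D : a b / a + b},
      forall a b, D (a * b) = D a * x b + x a * D b &
      forall c : F, D c%:A = (der c)%:A].

(** The conditions in [derivation_over] are what makes [a] |-> [x a] + [D a] eps an [F]-algebra
    morphism. Their proof is an argument so that the morphism instances can attach to this map. *)
Definition dual_point (_ : derivation_over) (a : A) : dual R := (x a, D a).

Hypothesis D_der : derivation_over.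

Lemma dual_point_nmod : nmod_morphism (dual_point D_der).
Proof.
case: D_der => DD DM DF; have D0 : D 0 = 0.
  by apply: (addrI (D 0)); rewrite -DD !addr0.
split=> [|a b]; rewrite /dual_point ?raddf0 ?D0 //.
by rewrite raddfD DD.
Qed.
Lemma dual_point_monoid : monoid_morphism (dual_point D_der).
Proof.
case: D_der => DD DM DF; split=> [|a b]; rewrite /dual_point.
  by have := DF 1; rewrite der1 !scale1r scale0r rmorph1 => ->.
by congr pair; rewrite ?rmorphM // DM addrC.
Qed.
Lemma dual_point_scalable : scalable (dual_point D_der).
Proof.
case: D_der => DD DM DF c a; congr pair => /=; first by rewrite linearZ.
by rewrite -[a in LHS]mul1r scalerAl DM DF linearZ /= rmorph1 addrC -!scalerAl !mul1r.
Qed.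

HB.instance Definition _ :=
  GRing.isNmodMorphism.Build A (dual R) (dual_point D_der) dual_point_nmod.
HB.instance Definition _ :=
  GRing.isMonoidMorphism.Build A (dual R) (dual_point D_der) dual_point_monoid.
HB.instance Definition _ :=
  GRing.isScalable.Build F A (dual R) *:%R (dual_point D_der) dual_point_scalable.

End DualPoint.

Section DualMap.
Variables (F : diffFieldType) (R S : comAlgType F) (f : {lrmorphism R -> S}).

Definition dual_map (u : dual R) : dual S := (f u.1, f u.2).

Lemma dual_map_zmod : zmod_morphism dual_map.
Proof. by move=> u v; rewrite /dual_map !raddfB. Qed.
Lemma dual_map_monoid : monoid_morphism dual_map.
Proof.
split=> [|u v]; rewrite /dual_map /= ?rmorph1 ?raddf0 //.
congr pair; first exact: rmorphM. rewrite raddfD. by rewrite /= !rmorphM.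
Qed.
Lemma dual_map_scalable : scalable dual_map.
Proof.
by move=> c u; congr pair; rewrite /= ?linearZ // raddfD /= !linearZ.
Qed.

HB.instance Definition _ :=
  GRing.isZmodMorphism.Build (dual R) (dual S) dual_map dual_map_zmod.
HB.instance Definition _ :=
  GRing.isMonoidMorphism.Build (dual R) (dual S) dual_map dual_map_monoid.
HB.instance Definition _ :=
  GRing.isScalable.Build F (dual R) (dual S) *:%R dual_map dual_map_scalable.

Definition restr_map (u : restr R) : restr S := f u.

Lemma restr_map_zmod : zmod_morphism restr_map.
Proof. exact: (@raddfB _ _ f). Qed.
Lemma restr_map_monoid : monoid_morphism restr_map.
Proof. by split; [apply: (@rmorph1 _ _ f)|apply: (@rmorphM _ _ f)]. Qed.
Lemma restr_map_scalable : scalable restr_map.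
Proof. by move=> c u; apply: (@linearZ_LR _ _ _ _ f (val c)). Qed.

HB.instance Definition _ :=
  GRing.isZmodMorphism.Build (restr R) (restr S) restr_map restr_map_zmod.
HB.instance Definition _ :=
  GRing.isMonoidMorphism.Build (restr R) (restr S) restr_map restr_map_monoid.
HB.instance Definition _ :=
  GRing.isScalable.Build (constants F) (restr R) (restr S) *:%R restr_map
    restr_map_scalable.

(* Scalars of [dual R] being twisted by the derivation of F, a |-> (a, 0) is
   linear over the constants only. *)
Definition dual_const (u : restr R) : restr (dual R) := (u, 0).

Lemma dual_const_zmod : zmod_morphism dual_const.
Proof. by move=> u v; congr pair; rewrite /= subr0. Qed.
Lemma dual_const_monoid : monoid_morphism dual_const.
Proof. by split=> // u v; congr pair; rewrite /= mulr0 mul0r addr0. Qed.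
Lemma dual_const_scalable : scalable dual_const.
Proof.
move=> c u; congr pair => /=.
by have /eqP -> := valP c; rewrite scale0r scaler0 addr0.
Qed.

HB.instance Definition _ :=
  GRing.isZmodMorphism.Build (restr R) (restr (dual R)) dual_const dual_const_zmod.
HB.instance Definition _ :=
  GRing.isMonoidMorphism.Build (restr R) (restr (dual R)) dual_const
    dual_const_monoid.
HB.instance Definition _ :=
  GRing.isScalable.Build (constants F) (restr R) (restr (dual R)) *:%R dual_const
    dual_const_scalable.

End DualMap.

(** * Points of torsors *)

Section TorsorAction.
Variables (F : diffFieldType) (G : linAlgGroup (constants F)) (X : actionData G).

Definition gpoint_map (R S : comAlgType F) (f : {lrmorphism R -> S})
    (g : gpoint G (restr R)) : gpoint G (restr S) := restr_map f \o g.

(** The map G(R) -> G(R[eps]) given by constants. It exists because [G] is defined over the field of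
    constants, over which [dual_const] is linear. *)
Definition gpoint_dual (R : comAlgType F) (g : gpoint G (restr R)) :
  gpoint G (restr (dual R)) := @dual_const F R \o g.

Lemma eq_point_ext (R : comAlgType F) (g g' : gpoint G (restr R)) :
  g =1 g' -> point_ext g =1 point_ext g'.
Proof. by move=> gg' t; apply: eq_bigr => p _; rewrite gg'. Qed.

Lemma eq_tact (R : comAlgType F) (x x' : tpoint X R) (g g' : gpoint G (restr R)) :
  x =1 x' -> g =1 g' -> tact x g =1 tact x' g'.
Proof.
by move=> xx' gg' a; apply: eq_bigr => p _ /=; rewrite xx' (eq_point_ext gg').
Qed.

Lemma point_ext_map (R S : comAlgType F) (f : {lrmorphism R -> S})
    (g : gpoint G (restr R)) t :
  f (point_ext g t) = point_ext (gpoint_map f g) t.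
Proof. rewrite [LHS]raddf_sum; apply: eq_bigr => p _ /=. exact: linearZ. Qed.

Lemma tact_map (R S : comAlgType F) (f : {lrmorphism R -> S})
    (x : tpoint X R) (g : gpoint G (restr R)) a :
  f (tact x g a) = tact (f \o x : tpoint X S) (gpoint_map f g) a.
Proof.
rewrite [LHS]raddf_sum; apply: eq_bigr => p _ /=.
by rewrite rmorphM /= point_ext_map.
Qed.

(** Coefficients in [F] are twisted by [der] in [dual R], while elements of K[G] go to constants;
    this is how [base_der] acts. *)
Lemma point_ext_dual (R : comAlgType F) (g : gpoint G (restr R)) t :
  point_ext (gpoint_dual g) t =
    (point_ext g t, point_ext g (base_der t)) :> dual R.
Proof.
elim/baseChange_ind: t => [|c a|t u IHt IHu].
- have [_ bZ] := base_der_extends (gcoord G).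
  have := bZ 0 0; rewrite !scale0r scaler0 addr0 => ->.
  by rewrite !raddf0.
- rewrite base_der_pure !point_ext_pure; congr pair => /=.
  by rewrite scaler0 add0r.
- by rewrite base_derD !raddfD /= IHt IHu.
Qed.

(** When [x] is a pair [(y, y \o d)], the second component is [tens_pair y (point_ext g)] applied to
    [tens_der d base_der] of the co-action. This links the condition on the co-action to points. *)
Lemma tact_dual (R : comAlgType F) (x : tpoint X (dual R))
    (g : gpoint G (restr R)) a :
  tact x (gpoint_dual g) a =
    (tact (@dual_re F R \o x : tpoint X R) g a,
     \sum_(p <- repr (tcoact X a))
       ((x p.1).2 * point_ext g p.2 + (x p.1).1 * point_ext g (base_der p.2)))
    :> dual R.
Proof.
rewrite [LHS]surjective_pairing dual_re_sum dual_im_sum; congr pair.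
  by apply: eq_bigr => p _ /=; rewrite point_ext_dual.
by apply: eq_bigr => p _ /=; rewrite point_ext_dual /= addrC.
Qed.

End TorsorAction.

Section DifferentialPoint.
Variables (F : diffFieldType) (G : linAlgGroup (constants F)) (X : torsor G).
Variables (d : tcoord X -> tcoord X) (hd : differential_structure d).

Lemma diff_over (R : comAlgType F) (x : tpoint X R) :
  derivation_over x (x \o d).
Proof.
case: hd => [[dD dM] dF _]; split=> [a b|a b|c] /=.
- by rewrite dD rmorphD.
- by rewrite dM rmorphD !rmorphM.
- by rewrite dF linearZ /= rmorph1.
Qed.

Definition diff_point (R : comAlgType F) (x : tpoint X R) : tpoint X (dual R) :=
  dual_point (diff_over x).

Lemma diff_point_tact (R : comAlgType F) (x : tpoint X R)
    (g : gpoint G (restr R)) :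
  diff_point (tact x g) =1 tact (diff_point x) (gpoint_dual g).
Proof.
move=> a; rewrite tact_dual; congr pair; case: hd => _ _ /(_ a) /= ->.
rewrite [LHS]raddf_sum; apply: eq_bigr => p _ /=.
by rewrite rmorphD /= !tens_pair_pure.
Qed.

End DifferentialPoint.

(** * Tensor products: inclusions, functoriality, contraction *)

Section TensorMaps.
Variables (k : fieldType) (A B : comAlgType k).

Definition tens_inl (a : A) : tens A B := pure a 1.
Definition tens_inr (b : B) : tens A B := pure 1 b.

Lemma pureZr (c : k) (a : A) (b : B) : pure a (c *: b) = c *: pure a b.
Proof. by case: (@pure_balanced k A B) => _ _ h; rewrite pureZl -h. Qed.

Lemma tens_inl_nmod : nmod_morphism tens_inl.
Proof.
case: (@pure_balanced k A B) => hl _ _; split=> [|a b]; last exact: hl.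
by have := @pureZl k A B 0 1 1; rewrite !scale0r.
Qed.
Lemma tens_inl_monoid : monoid_morphism tens_inl.
Proof. by split=> // a b; rewrite /tens_inl pureM mulr1. Qed.
Lemma tens_inl_scalable : scalable tens_inl.
Proof. by move=> c a; rewrite /tens_inl pureZl. Qed.

Lemma tens_inr_nmod : nmod_morphism tens_inr.
Proof.
case: (@pure_balanced k A B) => _ hr _; split=> [|a b]; last exact: hr.
by have := pureZr 0 (1 : A) (1 : B); rewrite !scale0r.
Qed.
Lemma tens_inr_monoid : monoid_morphism tens_inr.
Proof. by split=> // a b; rewrite /tens_inr pureM mulr1. Qed.
Lemma tens_inr_scalable : scalable tens_inr.
Proof. by move=> c a; rewrite /tens_inr pureZr. Qed.

HB.instance Definition _ :=
  GRing.isNmodMorphism.Build A (tens A B) tens_inl tens_inl_nmod.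
HB.instance Definition _ :=
  GRing.isMonoidMorphism.Build A (tens A B) tens_inl tens_inl_monoid.
HB.instance Definition _ :=
  GRing.isScalable.Build k A (tens A B) *:%R tens_inl tens_inl_scalable.
HB.instance Definition _ :=
  GRing.isNmodMorphism.Build B (tens A B) tens_inr tens_inr_nmod.
HB.instance Definition _ :=
  GRing.isMonoidMorphism.Build B (tens A B) tens_inr tens_inr_monoid.
HB.instance Definition _ :=
  GRing.isScalable.Build k B (tens A B) *:%R tens_inr tens_inr_scalable.

End TensorMaps.
Arguments tens_inl {k A B}.
Arguments tens_inr {k A B}.

Definition tens_map (k : fieldType) (A B C : comAlgType k)
    (f : {lrmorphism B -> C}) : {lrmorphism tens A B -> tens A C} :=
  tens_pair (@tens_inl k A C) (tens_inr \o f).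

Arguments tens_map {k A B C} f.

Lemma tens_map_pure (k : fieldType) (A B C : comAlgType k)
    (f : {lrmorphism B -> C}) (a : A) b : tens_map f (pure a b) = pure a (f b).
Proof. by rewrite [LHS]tens_pair_pure /= [LHS]pureM mulr1 mul1r. Qed.

Section Contraction.
Variables (k : fieldType) (A : comAlgType k).
Variables (l : A -> k) (l1 : l 1 = 1).
Hypothesis l_lin : forall c x y, l (c *: x + y) = c * l x + l y.

(** The map [l] (x) id, a [B]-linear retraction of [tens_inr]; in use, [l] comes from
    [unit_retraction]. *)
Definition contract (B : comAlgType k) (t : tens A B) : B :=
  tens_lift (fun a b => l a *: b) t.

Lemma contract_balanced (B : comAlgType k) :
  balanced (fun a (b : B) => l a *: b).
Proof.
have lD x y : l (x + y) = l x + l y.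
  by have := l_lin 1 x y; rewrite scale1r mul1r.
have l0 : l 0 = 0 by apply: (addrI (l 0)); rewrite -lD !addr0.
have lZ c x : l (c *: x) = c * l x by have := l_lin c x 0; rewrite !addr0 l0 addr0.
split=> [a a' b|a b b'|c a b]; first by rewrite lD scalerDl.
  by rewrite scalerDr.
by rewrite lZ scalerA mulrC.
Qed.

Lemma contract_pure (B : comAlgType k) a (b : B) :
  contract (pure a b) = l a *: b.
Proof. exact/tens_lift_pure/contract_balanced. Qed.

Lemma contractD (B : comAlgType k) : {morph @contract B : t u / t + u}.
Proof. exact/tens_liftD/contract_balanced. Qed.

Lemma contract0 (B : comAlgType k) : contract (0 : tens A B) = 0.
Proof. exact/tens_lift0/contract_balanced. Qed.

Lemma contract_sum (B : comAlgType k) I (r : seq I) (f : I -> tens A B) :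
  contract (\sum_(i <- r) f i) = \sum_(i <- r) contract (f i).
Proof. exact: (big_morph _ (@contractD B) (contract0 B)). Qed.

Lemma contract_inr (B : comAlgType k) (b : B) : contract (tens_inr b) = b.
Proof. by rewrite contract_pure l1 scale1r. Qed.

Lemma contractM (B : comAlgType k) (t : tens A B) b :
  contract (t * tens_inr b) = contract t * b.
Proof.
elim/tens_ind: t => [|a b'|t u IHt IHu].
- by rewrite mul0r contract0 mul0r.
- by rewrite pureM mulr1 !contract_pure scalerAl.
- by rewrite mulrDl !contractD IHt IHu mulrDl.
Qed.

(** This naturality lets contraction pass through the co-action and through [psi]. *)
Lemma contract_map (B C : comAlgType k) (f : {lrmorphism B -> C}) t :
  contract (tens_map f t : tens A C) = f (contract t).
Proof.
elim/tens_ind: t => [|a b|t u IHt IHu].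
- by rewrite raddf0 !contract0 raddf0.
- by rewrite tens_map_pure !contract_pure linearZ.
- by rewrite raddfD !contractD raddfD /= IHt IHu.
Qed.

End Contraction.

(** * The co-action as translate of a universal point *)

Section UniversalPoint.
Variables (F : diffFieldType) (A : comAlgType (constants F)).

Definition base_unit (a : A) : restr (baseChange A) := bpure 1 a.

Lemma base_unit_nmod : nmod_morphism base_unit.
Proof. exact: (@tens_inr_nmod _ (restr F^o) A). Qed.
Lemma base_unit_monoid : monoid_morphism base_unit.
Proof. exact: (@tens_inr_monoid _ (restr F^o) A). Qed.
Lemma base_unit_scalable : scalable base_unit.
Proof.
move=> c a; case: (@pure_balanced _ (restr F^o) A) => _ _ h.
by rewrite [RHS](bpureZ (val c)) [LHS](esym (h _ _ _)).
Qed.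

HB.instance Definition _ :=
  GRing.isNmodMorphism.Build A (restr (baseChange A)) base_unit base_unit_nmod.
HB.instance Definition _ :=
  GRing.isMonoidMorphism.Build A (restr (baseChange A)) base_unit base_unit_monoid.
HB.instance Definition _ :=
  GRing.isScalable.Build (constants F) A (restr (baseChange A)) *:%R base_unit
    base_unit_scalable.

Lemma point_ext_base_unit (t : baseChange A) : point_ext base_unit t = t.
Proof.
elim/baseChange_ind: t => [|c a|t u IHt IHu]; first by rewrite raddf0.
  by rewrite point_ext_pure bpureZ mulr1.
by rewrite raddfD /= IHt IHu.
Qed.

End UniversalPoint.

Section CoactionPoint.
Variables (F : diffFieldType) (G : linAlgGroup (constants F)) (X : actionData G).

Definition universal_gpoint :
    gpoint G (restr (tens (tcoord X) (baseChange (gcoord G)))) :=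
  gpoint_map tens_inr (@base_unit F (gcoord G) : gpoint G _).

Lemma point_ext_universal t :
  point_ext universal_gpoint t = tens_inr t.
Proof. by rewrite -point_ext_map point_ext_base_unit. Qed.

(** Yoneda: the co-action is x.g for the universal x and g over F[X] (x) F[G], so facts about points
    apply to it. *)
Lemma tcoactE a :
  tcoact X a = tact (tens_inl : tpoint X _) universal_gpoint a.
Proof.
rewrite [LHS]tens_sum; apply: eq_bigr => p _ /=.
by rewrite point_ext_universal /= [RHS]pureM mulr1 mul1r.
Qed.

End CoactionPoint.

Lemma gmul_comp (k : fieldType) (G : groupData k) (R S : comAlgType k)
    (f : {lrmorphism R -> S}) (g h : gpoint G R) a :
  f (gmul g h a) = gmul (f \o g : gpoint G S) (f \o h : gpoint G S) a.
Proof. by rewrite [LHS]raddf_sum; apply: eq_bigr => p _ /=; rewrite rmorphM. Qed.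

Section DualAction.
Variables (F : diffFieldType) (G : linAlgGroup (constants F)).

Lemma tact_dual_map (X : actionData G) (R S : comAlgType F)
    (f : {lrmorphism R -> S}) (x : tpoint X (dual R)) (g : gpoint G (restr R)) a :
  dual_map f (tact x (gpoint_dual g) a) =
    tact (dual_map f \o x : tpoint X _) (gpoint_dual (gpoint_map f g)) a.
Proof.
rewrite tact_map; apply: eq_tact => // b.
by congr pair; rewrite /= raddf0.
Qed.

Lemma tact_inj (X : torsor G) (R : comAlgType F) (x : tpoint X R)
    (g h : gpoint G (restr R)) : tact x g =1 tact x h -> g =1 h.
Proof.
case: (tact_simply_transitive x (tact x h)) => k [_ k_uniq] xgh b.
by rewrite -(k_uniq h) // (k_uniq g) // => a; rewrite xgh.
Qed.

End DualAction.

(** * Differential structures from points over the dual numbers *)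

Section TranslatedPoint.
Variables (F : diffFieldType) (G : linAlgGroup (constants F)) (X : torsor G).
Variables (R : comAlgType F) (x : tpoint X (dual R)).
Variables (l : R -> F) (l1 : l 1 = 1).
Hypothesis l_lin : forall c a b, l (c *: a + b) = c * l a + l b.
Variable g : gpoint G (restr (tens R (tcoord X))).
Hypothesis inrE :
  tens_inr =1 tact (tens_inl \o (@dual_re F R \o x) : tpoint X _) g.

(** By [inrE], [g] moves the reduction of [x] to the universal point of [X] over R (x) F[X]. Moving
    [x] itself by the constant lift of [g] lifts that universal point to the dual numbers. *)
Definition translate : tpoint X (dual (tens R (tcoord X))) :=
  tact (dual_map (@tens_inl _ R (tcoord X)) \o x : tpoint X _) (gpoint_dual g).

Definition averaged_der (a : tcoord X) : tcoord X := contract l (translate a).2.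

Lemma translate_re a : (translate a).1 = tens_inr a.
Proof. by rewrite tact_dual inrE; apply: eq_tact. Qed.

(** Both sides are translates of the same image of [x] by constant group elements. These can be
    compared through their effect on the reduction of [x], where the action is free. *)
Lemma translate_coact a :
  dual_map (tens_map (tcoact X)) (translate a) =
    tact (dual_map (tens_map tens_inl) \o translate : tpoint X _)
      (gpoint_dual (gpoint_map tens_inr (universal_gpoint X))) a.
Proof.
pose S := tens (tcoord X) (baseChange (gcoord G)).
pose f0 : {lrmorphism tens R (tcoord X) -> tens R S} := tens_map tens_inl.
pose f1 : {lrmorphism tens R (tcoord X) -> tens R S} := tens_map (tcoact X).
pose u : gpoint G (restr (tens R S)) := gpoint_map tens_inr (universal_gpoint X).
pose i : tpoint X (tens R S) := tens_inl \o (@dual_re F R \o x).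
have f0i b : f0 (tens_inl b) = tens_inl b by rewrite /f0 tens_map_pure rmorph1.
have f1i b : f1 (tens_inl b) = tens_inl b by rewrite /f1 tens_map_pure rmorph1.
(* Both sides carry [i] to [tens_inr \o tcoact X]. *)
have gE : gpoint_map f1 g =1 gmul (gpoint_map f0 g) u.
  apply: (@tact_inj F G X _ i) => b.
  apply: etrans (tactM _ _ _ _); transitivity (f1 (tens_inr b)).
    by rewrite inrE tact_map; apply: eq_tact => // c; rewrite /= f1i.
  rewrite [LHS]tens_map_pure tcoactE [LHS](tact_map tens_inr).
  apply: eq_tact => // c; rewrite /= /i.
  transitivity (f0 (tens_inr c)); first by rewrite [RHS]tens_map_pure.
  by rewrite inrE tact_map; apply: eq_tact => // e; rewrite /= f0i.
rewrite [LHS]tact_dual_map.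
pose i' : tpoint X (dual (tens R S)) := dual_map (@tens_inl _ R S) \o x.
have e1 : tact (dual_map f1 \o (dual_map tens_inl \o x) : tpoint X _)
     (gpoint_dual (gpoint_map f1 g)) =1
   tact i' (gmul (gpoint_dual (gpoint_map f0 g)) (gpoint_dual u)).
  apply: eq_tact => b; first by congr pair; apply: f1i.
  rewrite -(gmul_comp (@dual_const F _)).
  exact: (congr1 (@dual_const F _) (gE b)).
rewrite [LHS]e1 -tactM; apply: eq_tact => // b.
rewrite [RHS]tact_dual_map; apply: eq_tact => // c.
by congr pair; rewrite /= [RHS]f0i.
Qed.

(** The first component of [translate a] is [tens_inr a], over which contraction is linear; hence
    the Leibniz rule. Compatibility with the co-action is the contracted second component of
    [translate_coact]. *)
Lemma averaged_der_structure : differential_structure averaged_der.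
Proof.
split=> [|c|a].
- split=> a b; rewrite /averaged_der.
    by rewrite raddfD contractD.
  rewrite rmorphM /= contractD // !translate_re addrC.
  by rewrite [tens_inr a * _]mulrC !contractM // [contract _ _ * a]mulrC.
(* In the twisted algebra [dual], [c%:A] has second component [(der c)%:A]. *)
- rewrite /averaged_der; have -> : translate c%:A = c%:A by rewrite linearZ rmorph1.
  rewrite /= scaler0 add0r.
  by rewrite [_ *: _](esym (pureZr _ 1 1)) contract_inr.
have e := congr1 (fun t : dual _ => t.2) (translate_coact a).
transitivity (contract l (tens_map (tcoact X) (translate a).2)).
  by rewrite contract_map.
rewrite {}[tens_map _ _]e tact_dual.
have uE t : point_ext (gpoint_map (@tens_inr _ R _) (universal_gpoint X)) t =
    tens_inr (tens_inr t) by rewrite -point_ext_map point_ext_universal.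
rewrite contract_sum //; apply: eq_bigr => p _; rewrite contractD // !uE.
congr (_ + _).
  transitivity
    (contract l (tens_map tens_inl (translate p.1).2 * tens_inr (tens_inr p.2))) => //.
  by rewrite contractM // contract_map // [LHS]pureM mulr1 mul1r.
transitivity (contract l
  (tens_map tens_inl (translate p.1).1 * tens_inr (tens_inr (base_der p.2)))) => //.
rewrite translate_re contractM // contract_map // contract_inr //.
by rewrite [LHS]pureM mulr1 mul1r.
Qed.

End TranslatedPoint.

(** * Equivariant morphisms *)

Section EquivariantMorphism.
Variables (F : diffFieldType) (G G' : linAlgGroup (constants F)).
Variables (phi : groupMorphism G G') (X : torsor G) (X' : torsor G').
Variables (psi : {lrmorphism tcoord X' -> tcoord X}).
Hypothesis psi_eqv : equivariant phi psi.

Lemma pushforward_unique d d1 d2 :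
  differential_structure d1 -> differential_morphism psi d d1 ->
  differential_structure d2 -> differential_morphism psi d d2 -> d1 =1 d2.
Proof.
move=> h1 m1 h2 m2 b; have [l l1 l_lin] := unit_retraction (tcoord X).
pose y : tpoint X' (tens (tcoord X) (tcoord X')) := tens_inl \o psi.
have [g [yg _]] := tact_simply_transitive y tens_inr.
have e d0 (h0 : differential_structure d0) :
    tens_inr (d0 b) = (tact (diff_point h0 y) (gpoint_dual g) b).2.
  by rewrite -diff_point_tact /= yg.
suff inr12 : tens_inr (d1 b) = tens_inr (d2 b) :> tens (tcoord X) _.
  have := congr1 (fun t => contract l t) inr12.
  by rewrite !contract_inr.
apply: etrans (e _ h1) (etrans _ (esym (e _ h2))); apply: congr1.
apply: eq_tact => // c.
by congr pair; rewrite /= m1 m2.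
Qed.

Lemma pushforward_exists d : differential_structure d ->
  exists2 d', differential_structure d' & differential_morphism psi d d'.
Proof.
move=> hd; have [l l1 l_lin] := unit_retraction (tcoord X).
pose A := tcoord X; pose i : tpoint X A := idfun.
pose x : tpoint X' (dual A) := diff_point hd i \o psi.
pose y : tpoint X' (tens A (tcoord X')) := tens_inl \o (@dual_re F A \o x).
have [g [yg _]] := tact_simply_transitive y tens_inr.
exists (averaged_der x l g); first exact: averaged_der_structure.
(* Specialised along [psi], the universal point of [X'] becomes [tens_inr \o psi], which comes from
   a point of [X]; [h] is the translation from [tens_inl] to that point. *)
move=> b; pose f : {lrmorphism tens A (tcoord X') -> tens A A} := tens_map psi.
have [h [i1h _]] := tact_simply_transitive (tens_inl : tpoint X (tens A A)) tens_inr.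
pose h' : gpoint G' (restr (tens A A)) := h \o phi.
have fi a : f (tens_inl a) = tens_inl a by rewrite /f tens_map_pure rmorph1.
(* Both sides carry [tens_inl \o psi] to [tens_inr \o psi], and the action on [X'] is free. *)
have gh : gpoint_map f g =1 h'.
  apply: (@tact_inj _ _ X' _ (tens_inl \o psi)) => c.
  rewrite -[RHS](psi_eqv tens_inl h) /= -[RHS]i1h.
  transitivity (f (tens_inr c)); last by rewrite [LHS]tens_map_pure.
  by rewrite yg tact_map; apply: eq_tact => // e; rewrite /= fi.
rewrite /averaged_der -contract_map //.
have -> : tens_map psi (translate x g b).2 = tens_inr (d (psi b)).
  transitivity (diff_point hd (tact (tens_inl : tpoint X (tens A A)) h) (psi b)).2.
    rewrite diff_point_tact.
    transitivity (dual_map f (translate x g b)).2 => //.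
    rewrite tact_dual_map; congr (_ .2).
    rewrite [RHS](psi_eqv (diff_point hd tens_inl) (gpoint_dual h)).
    have e1 : (dual_map f \o (dual_map tens_inl \o x) : tpoint X' _) =1
        (diff_point hd tens_inl \o psi : tpoint X' _).
      by move=> c; congr pair; apply: fi.
    have e2 : gpoint_dual (gpoint_map f g) =1
        (gpoint_dual h \o phi : gpoint G' (restr (dual (tens A A)))).
      by move=> c; apply: (congr1 (@dual_const F _) (gh c)).
    exact: (eq_tact e1 e2).
  exact: (esym (i1h _)).
exact: contract_inr.
Qed.

(** The hypothesis on [x] says that [x \o psi] is the differential lift of its reduction.
    Translation by constant points preserves this, so it also holds at the universal point;
    contraction then gives compatibility with [psi]. *)
Lemma pullback_exists d' (R : comAlgType F) (x : tpoint X (dual R)) :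
  differential_structure d' ->
  (forall b, (x (psi b)).2 = (x (psi (d' b))).1) ->
  exists2 d, differential_structure d & differential_morphism psi d d'.
Proof.
move=> hd' xd'; have [l l1 l_lin] := unit_retraction R.
pose y : tpoint X (tens R (tcoord X)) := tens_inl \o (@dual_re F R \o x).
have [g [yg _]] := tact_simply_transitive y tens_inr.
exists (averaged_der x l g); first exact: averaged_der_structure.
move=> b; rewrite /averaged_der; symmetry.
have -> : (translate x g (psi b)).2 = tens_inr (psi (d' b)).
  transitivity (diff_point hd' (tact (y \o psi : tpoint X' _)
      (g \o phi : gpoint G' (restr _))) b).2.
    rewrite diff_point_tact; congr (_ .2).
    rewrite [LHS](psi_eqv (dual_map tens_inl \o x) (gpoint_dual g)).
    have e1 : (dual_map tens_inl \o x \o psi : tpoint X' _) =1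
        diff_point hd' (y \o psi).
      by move=> c; congr pair; rewrite /= xd'.
    have e2 : (gpoint_dual g \o phi : gpoint G' (restr (dual (tens R (tcoord X)))))
        =1 gpoint_dual (g \o phi : gpoint G' (restr _)) by [].
    exact: (eq_tact e1 e2).
  by rewrite yg; symmetry; apply: psi_eqv.
exact: contract_inr.
Qed.

End EquivariantMorphism.

(** * Fields *)

(** The empty set is added to the family as the union of the empty chain. If it is the maximal
    element found, then [S0] is empty too. *)
Lemma Zorn_above (T : Type) (P : set (set T)) (S0 : set T) : P S0 ->
  (forall F : set (set T), (exists S, F S) -> (F `<=` P)%classic ->
     total_on F subset -> P (\bigcup_(X in F) X)%classic) ->
  exists S, [/\ (S0 `<=` S)%classic, P S &
    forall S', (S `<=` S')%classic -> P S' -> (S' `<=` S)%classic].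
Proof.
move=> PS0 Pchain; pose P' (S : set T) := P S /\ (S0 `<=` S)%classic.
have [F FP Ftot|S [SP Smax]] := @Zorn_bigcup T [set S | S = set0 \/ P' S]%classic.
  pose F' (S : set T) := F S /\ P' S.
  have FF' : (\bigcup_(X in F) X = \bigcup_(X in F') X)%classic.
    apply/seteqP; split=> x [S FS Sx]; last by case: FS => FS _; exists S.
    by exists S => //; split=> //; case: (FP _ FS) => // S_0; rewrite S_0 in Sx.
  have [[S [FS [PS S0S]]]|noS] := pselect (exists S, F' S).
    right; rewrite FF'; split; last by move=> x S0x; exists S => //; apply: S0S.
    apply: Pchain => [|X [_ []] //|X Y [FX _] [FY _]]; last exact: Ftot.
    by exists S.
  left; rewrite FF'; apply/seteqP; split=> // x [X F'X _].
  by apply: noS; exists X.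
have {SP} [PS S0S] : P' S.
  case: SP => // S_0; have PP : P' S0 by split.
  have [S0_0|/eqP/set0P [x S0x]] := pselect (S0 = set0).
    by rewrite S_0 -S0_0.
  exfalso; apply: (Smax S0); last by right.
  by rewrite S_0; split=> // /(_ _ S0x).
exists S; split=> // S' SS' PS'; apply: contrapT => nsub.
by apply: (Smax S'); [split|right; split=> // x /S0S /SS'].
Qed.

Lemma domain_field (D : comNzRingType) :
  (forall x y : D, x * y = 0 -> (x == 0) || (y == 0)) ->
  exists (L : fieldType) (f : {rmorphism D -> L}), injective f.
Proof.
move=> D_dom; pose unit : pred D := fun x => `[< exists y, y * x = 1 >].
(* Non-units are sent to themselves, as [inv_out] demands. *)
pose inv (x : D) := if pselect (exists y, y * x = 1) is left h then sval (cid h) else x.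
have mulVx : {in unit, left_inverse 1 inv *%R}.
  by move=> x /asboolP ux; rewrite /inv; case: pselect => // h; case: cid.
have unitPl x y : y * x = 1 -> x \in unit by move=> yx; apply/asboolP; exists y.
have inv_out : {in [predC unit], inv =1 id}.
  by move=> x /asboolPn ux; rewrite /inv; case: pselect.
pose U : comUnitRingType := HB.pack (GRing.ComNzRing.sort D)
  (GRing.ComNzRing_hasMulInverse.Build D mulVx unitPl inv_out).
pose I : idomainType := HB.pack (GRing.ComUnitRing.sort U)
  (GRing.ComUnitRing_isIntegral.Build U D_dom).
exists {fraction I}, (@FracField.tofrac I : {rmorphism I -> {fraction I}}).
by move=> x y /eqP; rewrite tofrac_eq => /eqP.
Qed.

Lemma prime_ideal_field (C : comNzRingType) (P : {pred C}) : prime_ideal P ->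
  exists (L : fieldType) (f : {rmorphism C -> L}), forall a, (f a == 0) = (a \in P).
Proof.
case=> P_ideal P_prime.
pose I : prime_idealr C := HB.pack (P : C -> bool)
  (isIdealr.Build C P P_ideal) (isPrimeIdealrClosed.Build C P P_prime).
have [L [f f_inj]] := @domain_field {ideal_quot I} (@Quotient.rquot_IdomainAxiom C I).
exists L, (f \o \pi_({ideal_quot I})%qT) => a /=.
rewrite -(rmorph0 f) (inj_eq f_inj) -(rmorph0 \pi_({ideal_quot I})%qT).
by rewrite -Quotient.idealrBE subr0.
Qed.

(** The ideal is taken maximal among proper ones: elements outside it are invertible modulo it
    ([Sinv]), whence primality. *)
Lemma prime_ideal_above (C : comNzRingType) (I : set C) :
  I 0 -> ~ I 1 -> (forall a u v, I u -> I v -> I (a * u + v)) ->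
  exists2 P : {pred C}, prime_ideal P & forall a, I a -> a \in P.
Proof.
move=> I0 I1 Ilin; pose ideal (S : set C) := ~ S 1 /\
  forall a u v, S u -> S v -> S (a * u + v).
have [//|F _ Fideal Ftot|S [IS [S1 Slin] Smax]] := @Zorn_above C ideal I.
  split=> [[S FS S1]|a u v [S FS Su] [S' FS' S'v]]; first by case: (Fideal _ FS).
  case: (Ftot _ _ FS FS') => sub.
    by exists S' => //; have [_ h] := Fideal _ FS'; apply: h => //; apply: sub.
  by exists S => //; have [_ h] := Fideal _ FS; apply: h => //; apply: sub.
have S0 : S 0 := IS _ I0.
have SM a u : S u -> S (a * u) by move=> Su; rewrite -[_ * u]addr0; apply: Slin.
have SD u v : S u -> S v -> S (u + v).
  by move=> Su Sv; rewrite -[u]mul1r; apply: Slin.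
have Sinv u : ~ S u -> exists a, S (1 - a * u).
  move=> nSu; apply: contrapT => nex.
  pose S' : set C := fun v => exists a, S (v - a * u).
  apply: nSu; apply: (Smax S'); last by exists 1; rewrite mul1r subrr.
    by move=> v Sv; exists 0; rewrite mul0r subr0.
  split=> [[a Sa]|c v w [a Sa] [b Sb]]; first by apply: nex; exists a.
  exists (c * a + b); rewrite mulrDl opprD addrACA -mulrA -mulrBr.
  exact: Slin.
exists (fun a => `[< S a >]); last by move=> a /IS Sa; apply/asboolP.
split; first split.
- exact/asboolP.
- exact/asboolP.
- by move=> a u v /asboolP Su /asboolP Sv; apply/asboolP/Slin.
move=> u v /asboolP Suv; apply: contrapT => /negP; rewrite negb_or.
move=> /andP[/asboolP nSu /asboolP nSv]; have [a Sa] := Sinv u nSu.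
apply: nSv; have := SD _ _ (SM v _ Sa) (SM a _ Suv).
by rewrite mulrBr mulr1 [v * (a * u)]mulrCA [v * u]mulrC subrK.
Qed.

Lemma ideal_field (C : comNzRingType) (I : set C) :
  I 0 -> ~ I 1 -> (forall a u v, I u -> I v -> I (a * u + v)) ->
  exists (L : fieldType) (f : {rmorphism C -> L}), forall a, I a -> f a = 0.
Proof.
move=> I0 I1 Ilin; have [P P_prime IP] := prime_ideal_above I0 I1 Ilin.
have [L [f fP]] := prime_ideal_field P_prime.
by exists L, f => a Ia; apply/eqP; rewrite fP IP.
Qed.

Lemma horner_shift (R : comNzRingType) (p : {poly R}) (x h : R) :
  h * h = 0 -> p.[x + h] = p.[x] + p^`().[x] * h.
Proof.
move=> hh; elim/poly_ind: p => [|p c IHp]; first by rewrite deriv0 !horner0 mul0r addr0.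
rewrite derivMXaddC !hornerMXaddC hornerD hornerMX IHp.
rewrite mulrDl !mulrDr -[_ * h * h]mulrA hh mulr0 addr0 mulrDl mulrAC.
by rewrite -!addrA; congr (_ + _); rewrite [c + _]addrC addrA.
Qed.

(** * Extension of derivations in characteristic 0 *)

Section DerivationExtension.
Variable L : fieldType.
Implicit Types (S : set (dual_numbers L)) (z : dual_numbers L).

Definition subring_set S := [/\ S 1, forall u v, S u -> S v -> S (u - v) &
  forall u v, S u -> S v -> S (u * v)].

(** For a subring [S] of the dual numbers: [S] is the graph of a derivation from a subring of [L] to
    [L]. *)
Definition separated S := forall u, S u -> u.1 = 0 -> u = 0.

Definition coefs_in S : set {poly dual_numbers L} := fun p => forall i, S p`_i.


Lemma coefs_subring S : subring_set S -> [/\ coefs_in S 0, coefs_in S 1,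
  forall p q, coefs_in S p -> coefs_in S q -> coefs_in S (p - q) &
  forall p q, coefs_in S p -> coefs_in S q -> coefs_in S (p * q)].
Proof.
case=> S1 SB SM; have S0 : S 0 by rewrite -(subrr 1); apply: SB.
have SN v : S v -> S (- v) by move=> Sv; rewrite -[- v]add0r; apply: SB.
have SD u v : S u -> S v -> S (u + v).
  by move=> Su Sv; rewrite -[v]opprK; apply/SB/SN.
split=> [i|i|p q Sp Sq i|p q Sp Sq i].
- by rewrite coef0.
- by rewrite coef1; case: (i == _).
- by rewrite coefB; apply: SB.
- by rewrite coefM; elim/big_ind: _ => // j _; apply: SM.
Qed.

Lemma coefsC S c : S 0 -> S c -> coefs_in S c%:P.
Proof. by move=> S0 Sc i; rewrite coefC; case: (i == _). Qed.

Lemma coefsX S : S 0 -> S 1 -> coefs_in S 'X.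
Proof. by move=> S0 Sc i; rewrite coefX; case: (i == _). Qed.

Lemma adjoin_subring S z : subring_set S ->
  subring_set (fun u => exists2 p, coefs_in S p & u = p.[z]).
Proof.
move=> Sr; have [_ c1 cB cM] := coefs_subring Sr.
split=> [|u v [p Sp ->] [q Sq ->]|u v [p Sp ->] [q Sq ->]].
- by exists 1; rewrite ?hornerC.
- by exists (p - q); rewrite ?hornerD ?hornerN //; apply: cB.
- by exists (p * q); rewrite ?hornerM //; apply: cM.
Qed.

Lemma dual_horner_re (p : {poly dual_numbers L}) x u v :
  (p.[(x, u)]).1 = (p.[(x, v)]).1.
Proof.
elim/poly_ind: p => [|p c IHp]; first by rewrite !horner0.
by rewrite !hornerMXaddC /= IHp.
Qed.

(* A minimal relation p0 of x over S has p0'(x) != 0, because the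
   characteristic is 0; this determines the derivative u of x, and every other
   relation reduces to p0 by pseudo-division. *)
Lemma adjoin_separated S (x : L) : [pchar L] =i pred0 ->
  subring_set S -> separated S ->
  exists u, separated (fun v => exists2 p, coefs_in S p & v = p.[(x, u)]).
Proof.
move=> charL Sr Ssep; have [c0 c1 cB cM] := coefs_subring Sr.
have [S1 SB SM] := Sr; have S0 : S 0 by rewrite -(subrr 1); apply: SB.
pose rel p := [/\ p != 0, coefs_in S p & (p.[((x, 0) : dual_numbers L)]).1 = 0].
have [[p1 rel_p1]|norel] := pselect (exists p, rel p); last first.
  (* Without a relation the derivative of [x] is free; 0 is chosen. *)
  exists 0 => v [p Sp ->] p0; case: (eqVneq p 0) => [->|pn0]; first exact: horner0.
  by case: norel; exists p.
pose P n := `[< exists2 p, rel p & size p = n >].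
have exP : exists n, P n by exists (size p1); apply/asboolP; exists p1.
case: (ex_minnP exP) => n /asboolP[p [p0 Sp px] pn] n_min {p1 rel_p1 exP}.
have min q : coefs_in S q -> (q.[((x, 0) : dual_numbers L)]).1 = 0 ->
    (size q < n)%N -> q = 0.
  move=> Sq qx; apply: contraTeq => q0; rewrite -leqNgt; apply: n_min.
  by apply/asboolP; exists q.
have natS m a : S a -> S (a *+ m).
  move=> Sa; elim: m => [|m IHm]; first by rewrite mulr0n.
  rewrite mulrSr -[X in _ + X]opprK; apply: (SB) => //.
  by rewrite -[- a]add0r; apply: SB.
have lc1 : (lead_coef p).1 != 0.
  apply/eqP => /Ssep; rewrite -lead_coef_eq0 in p0.
  by move=> e; move/eqP: p0; apply; apply: e; apply: Sp.
have p'x : (p^`().[((x, 0) : dual_numbers L)]).1 != 0.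
  apply/eqP => p'x; have p'0 : p^`() = 0.
    apply: min => [i||]; rewrite ?coef_deriv //; first exact: natS.
    by rewrite -pn; apply: lt_size_deriv.
  have p_gt1 : (1 < size p)%N.
    rewrite ltnNge; apply/negP => /size1_polyC pc.
    by move: px lc1; rewrite pc hornerC lead_coefC => ->; rewrite eqxx.
  have [m pm] : exists m, size p = m.+2.
    by case: (size p) p_gt1 => [|[|m]] // _; exists m.
  have := congr1 (fun q : {poly dual_numbers L} => (q`_m).1) p'0.
  rewrite coef_deriv coef0 /= => /eqP.
  have natmul1 (w : dual_numbers L) k : (w *+ k).1 = w.1 *+ k.
    by elim: k => [|k IHk] //; rewrite !mulrS -IHk.
  rewrite natmul1.
  rewrite -mulr_natr mulf_eq0; have := lc1; rewrite lead_coefE pm /= => /negPf ->.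
  by rewrite ((pcharf0P L).1 charL).
(* The value forced by [p.[(x, u)] = 0], through the first-order Taylor formula [horner_shift]. *)
pose u := - (p.[((x, 0) : dual_numbers L)]).2 / (p^`().[((x, 0) : dual_numbers L)]).1.
have xu : ((x, u) : dual_numbers L) = (x, 0) + (0, u).
  by congr pair; rewrite /= ?addr0 ?add0r.
have pz : p.[((x, u) : dual_numbers L)] = 0.
  rewrite xu horner_shift; last by congr pair; rewrite /= !mul0r ?mulr0 ?addr0.
  congr pair => /=; first by rewrite mulr0 addr0.
  by rewrite mulr0 addr0 /u mulrC divfK // subrr.
exists u => v [q Sq ->{v}]; move: {-1}(size q) (leqnn (size q)) => m.
elim: m q Sq => [|m IHm] q Sq qm qz.
  by move: qm; rewrite leqn0 size_poly_eq0 => /eqP ->; rewrite horner0.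
have [qn|nq] := ltnP (size q) n.
  by rewrite (min q) ?horner0 // (dual_horner_re _ _ _ u).
(* [S] is only a ring, so [q] is multiplied by the leading coefficient of [p], whose first component
   [lc1] allows to cancel at the end. *)
pose r := (lead_coef p)%:P * q - (lead_coef q)%:P * 'X^(size q - n) * p.
have rz : r.[(x, u)] = lead_coef p * q.[(x, u)].
  by rewrite /r hornerD hornerN !hornerM !hornerC pz mulr0 subr0.
have n_gt0 : (0 < n)%N by rewrite -pn size_poly_gt0.
have SC c : S c -> coefs_in S c%:P by apply: coefsC.
have SXn k : coefs_in S 'X^k by move=> i; rewrite coefXn; case: (i == _).
have Sr' : coefs_in S r.
  exact: cB (cM _ _ (SC _ (Sp _)) Sq) (cM _ _ (cM _ _ (SC _ (Sq _)) (SXn _)) Sp).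
have r0 : r.[(x, u)] = 0.
  apply: IHm => //; last by rewrite rz /= qz mulr0.
  apply/leq_sizeP => j mj; rewrite /r coefB coefCM -mulrA coefCM coefXnM.
  have [jq|qj] := ltnP j (size q).
    have jE : size q = j.+1.
      by apply/eqP; rewrite eqn_leq jq (leq_trans qm).
    rewrite jE ltn_subRL addnC -[X in (_ < X)%N]addn1 ltn_add2l ltnS leqn0.
    rewrite -[(n == 0)%N]negbK -lt0n n_gt0 subnBA -?jE // jE -addn1 subnDl subn1.
    by rewrite ![lead_coef _]lead_coefE pn jE mulrC subrr.
  rewrite !nth_default ?mulr0 ?sub0r ?if_same ?mulr0 ?oppr0 // pn.
  by rewrite leq_subRL ?subnK // (leq_trans (leq_subr _ _)).
have := congr1 snd rz; rewrite r0 /= qz mulr0 addr0 => /esym /eqP.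
rewrite mulf_eq0 (negPf lc1) /= => /eqP q2.
by rewrite [LHS]surjective_pairing qz q2.
Qed.

(** A maximal separated subring above [S0] has an element over every [x], by [adjoin_separated]; it
    is therefore the graph of a derivation on all of [L]. *)
Lemma derivation_extension S0 : [pchar L] =i pred0 ->
  subring_set S0 -> separated S0 ->
  exists2 D : L -> L, derivation D & forall z, S0 z -> D z.1 = z.2.
Proof.
move=> charL Sr0 Ssep0; pose P S := subring_set S /\ separated S.
have [//|F [S FS] FP Ftot|S [S0S [Sr Ssep] Smax]] := @Zorn_above _ P S0.
  have ub u v : (\bigcup_(X in F) X)%classic u -> (\bigcup_(X in F) X)%classic v ->
      exists X, [/\ F X, X u & X v].
    move=> [X FX Xu] [Y FY Yv].
    by case: (Ftot _ _ FX FY) => sub; [exists Y|exists X]; split=> //; apply: sub.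
  split; last by move=> u [X FX Xu]; have [_] := FP _ FX; apply.
  split; first by exists S => //; have [[]] := FP _ FS.
    by move=> u v Fu /(ub _ _ Fu)[X [FX Xu Xv]]; exists X => //;
      have [[_ h _] _] := FP _ FX; apply: h.
  by move=> u v Fu /(ub _ _ Fu)[X [FX Xu Xv]]; exists X => //;
    have [[_ _ h] _] := FP _ FX; apply: h.
have [S1 SB SM] := Sr; have SZ : S 0 by rewrite -(subrr 1); apply: SB.
have tot x : exists u, S (x, u).
  have [u usep] := adjoin_separated x charL Sr Ssep; exists u.
  apply: (Smax (fun v => exists2 p, coefs_in S p & v = p.[(x, u)])).
  - by move=> v Sv; exists v%:P; rewrite ?hornerC //; apply: coefsC.
  - by split=> //; apply: adjoin_subring.
  - by exists 'X; rewrite ?hornerX //; apply: coefsX.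
have uniq x u v : S (x, u) -> S (x, v) -> u = v.
  move=> Su Sv; have /Ssep := SB _ _ Su Sv.
  by rewrite /= subrr => /(_ erefl) [_ /eqP]; rewrite subr_eq0 => /eqP.
exists (fun x => sval (cid (tot x))); last first.
  by move=> [x u] /S0S Sxu; case: cid => v /= Sxv; apply: uniq Sxv Sxu.
split=> x y; case: cid => w /= Sw; case: cid => u /= Su; case: cid => v /= Sv.
  apply: uniq Sw _; have SNv := SB _ _ SZ Sv; have := SB _ _ Su SNv.
  by congr S; congr pair; rewrite /= sub0r opprK.
by apply: uniq Sw _; have := SM _ _ Su Sv; congr S; congr pair; rewrite /= addrC.
Qed.

End DerivationExtension.

(** * A prime ideal stable under a derivation *)

Section StablePrime.
Variables (C : comNzRingType) (d : C -> C) (L : fieldType) (y : {rmorphism C -> L}).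
Hypotheses (d_der : derivation d) (charL : [pchar L] =i pred0).

(** In characteristic 0, the kernel of the Taylor morphism to L[[T]] sending [a] to the sum of the
    [y (iter n d a)] T^n / n!. *)
Definition iter_ideal : {pred C} := fun a => `[< forall n, y (iter n d a) = 0 >].

Lemma iter_derD n : {morph iter n d : a b / a + b}.
Proof. by case: d_der => dD _ a b; elim: n => //= n ->; rewrite dD. Qed.

Lemma iter_der0 n : iter n d 0 = 0.
Proof. by apply: (addrI (iter n d 0)); rewrite -iter_derD !addr0. Qed.

Lemma iter_der_vanish n (a b : C) :
  (forall k, (k <= n)%N -> y (iter k d b) = 0) -> y (iter n d (a * b)) = 0.
Proof.
elim: n a b => [|n IHn] a b yb; first by rewrite rmorphM (yb 0%N) ?mulr0.
rewrite iterSr (proj2 d_der) iter_derD rmorphD !IHn ?addr0 // => k kn.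
  by rewrite -iterSr; apply: yb.
by apply: yb; apply: leqW.
Qed.

(** Only one term of the Leibniz expansion survives. The constant [c] built here is the binomial
    coefficient of i + j over i, by Pascal's rule; only its positivity is recorded. *)
Lemma iter_der_lead i j (a b : C) :
  (forall k, (k < i)%N -> y (iter k d a) = 0) ->
  (forall k, (k < j)%N -> y (iter k d b) = 0) ->
  exists2 c, (0 < c)%N &
    y (iter (i + j) d (a * b)) = c%:R * (y (iter i d a) * y (iter j d b)).
Proof.
elim: i a b j => [|i IHi] a b j.
  elim: j a b => [|j IHj] a b ya yb; first by exists 1%N; rewrite // rmorphM mul1r.
  have [//|k kj|c c0 e] := IHj a (d b); first by rewrite -iterSr; apply: yb.
  exists c => //; move: e; rewrite !add0n => e.
  rewrite iterSr (proj2 d_der) iter_derD rmorphD iter_der_vanish ?add0r.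
    by rewrite e -iterSr.
  by move=> k kj; apply: yb.
elim: j a b => [|j IHj] a b ya yb.
  have [k ki|//|c c0 e] := IHi (d a) b 0%N; first by rewrite -iterSr; apply: ya.
  exists c => //; move: e; rewrite !addn0 => e.
  rewrite iterSr (proj2 d_der) iter_derD rmorphD mulrC [a * _]mulrC.
  rewrite [X in _ + X]iter_der_vanish ?addr0; first by rewrite mulrC e -iterSr.
  by move=> k ki; apply: ya.
have [k ki|//|c c0 e] := IHi (d a) b j.+1; first by rewrite -iterSr; apply: ya.
have [//|k kj|c' c'0 e'] := IHj a (d b); first by rewrite -iterSr; apply: yb.
exists (c + c')%N; first by rewrite addn_gt0 c0.
rewrite addSn iterSr (proj2 d_der) iter_derD rmorphD e addnS -addSn e'.
by rewrite -!iterSr natrD mulrDl.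
Qed.

Lemma iter_ideal_stable a : a \in iter_ideal -> d a \in iter_ideal.
Proof. by move=> /asboolP ya; apply/asboolP => n; rewrite -iterSr. Qed.

(** The lowest orders of non-vanishing of two elements add up in their product, as the factor [c] is
    nonzero in [L]. *)
Lemma iter_ideal_prime : prime_ideal iter_ideal.
Proof.
split; first split.
- by apply/asboolP => n; rewrite iter_der0 rmorph0.
- by apply/asboolP => /(_ 0%N) /=/eqP; rewrite rmorph1 oner_eq0.
- move=> a u v /asboolP yu /asboolP yv; apply/asboolP => n.
  by rewrite iter_derD rmorphD yv addr0 iter_der_vanish.
have first u : u \notin iter_ideal ->
    exists2 i, y (iter i d u) != 0 & forall k, (k < i)%N -> y (iter k d u) = 0.
  move=> /asboolPn/existsNP exi.
  have {}exi : exists n, y (iter n d u) != 0 by case: exi => n /eqP ?; exists n.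
  case: (ex_minnP exi) => i yi imin; exists i => // k ki.
  by apply: contraTeq ki => yk; rewrite -leqNgt; apply: imin.
move=> u v uv; apply: contraT; rewrite negb_or.
move=> /andP[/first[i yi umin] /first[j yj vmin]].
have [c c0 e] := iter_der_lead umin vmin.
move/asboolP/(_ (i + j)%N)/eqP: uv; rewrite e !mulf_eq0 (negPf yi) (negPf yj) !orbF.
by rewrite ((pcharf0P L).1 charL) eqn0Ngt c0.
Qed.

End StablePrime.

(** * Extending a character of a subring to a linear functional *)

Section LinearExtension.
Variables (A B : comNzRingType) (L : fieldType).
Variables (f : {rmorphism A -> B}) (chi : {rmorphism A -> L}) (P : {pred B}).
Hypotheses (P_ideal : idealr_closed P) (chiP : forall a, (chi a == 0) = (f a \in P)).

(** Zorn on graphs: [ok] describes partial [A]-linear maps from [B] to [L] that kill [P], and [S0]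
    is the map [f a + p] |-> [chi a], single-valued by [chiP]. Such a map extends to any further [x]
    because [L] is a field. *)
Lemma linear_extension : exists2 r : B -> L, r 1 = 1 &
  forall a b b', r (f a * b + b') = chi a * r b + r b'.
Proof.
have [P0 _ Plin] := P_ideal.
have PM a b : b \in P -> a * b \in P by move=> Pb; rewrite -[_ * _]addr0; apply: Plin.
pose ok (S : set (B * L)) :=
  (forall a u v, S u -> S v -> S (f a * u.1 + v.1, chi a * u.2 + v.2)) /\
  (forall u, S u -> u.1 \in P -> u.2 = 0).
pose S0 : set (B * L) := fun u => exists a, u.1 - f a \in P /\ u.2 = chi a.
have [||S [S0S [Slin Ssep] Smax]] := @Zorn_above _ ok S0.
- split=> [a u v [b [Pu ->]] [c [Pv ->]]|u [a [Pu ->]] Pu1].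
    exists (a * b + c); split=> /=; last by rewrite rmorphD rmorphM.
    by rewrite rmorphD rmorphM opprD addrACA -mulrBr; apply: Plin.
  apply/eqP; rewrite chiP; have := Plin (-1) _ _ Pu Pu1.
  by rewrite mulN1r opprB subrK.
- move=> F [S FS] Fok Ftot; split=> [a u v [X FX Xu] [Y FY Yv]|u [X FX Xu]].
    case: (Ftot _ _ FX FY) => sub.
      by exists Y => //; have [h _] := Fok _ FY; apply: h => //; apply: sub.
    by exists X => //; have [h _] := Fok _ FX; apply: h => //; apply: sub.
  by have [_] := Fok _ FX; apply.
have S1 : S (1, 1) by apply: S0S; exists 1; rewrite !rmorph1 subrr.
have S00 : S (0, 0) by apply: S0S; exists 0; rewrite !rmorph0 subrr.
have SP p : p \in P -> S (p, 0).
  by move=> Pp; apply: S0S; exists 0; rewrite !rmorph0 subr0.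
have SZ a u : S u -> S (f a * u.1, chi a * u.2).
  by move=> Su; have := Slin a _ _ Su S00; rewrite !addr0.
have SD u v : S u -> S v -> S (u.1 + v.1, u.2 + v.2).
  by move=> Su Sv; have := Slin 1 _ _ Su Sv; rewrite !rmorph1 !mul1r.
pose adj x c : set (B * L) := fun u =>
  exists a, S (u.1 - f a * x, u.2 - chi a * c).
have adj_max x c : (forall u, adj x c u -> u.1 \in P -> u.2 = 0) -> S (x, c).
  move=> asep; apply: (Smax (adj x c)).
  - by move=> u Su; exists 0; rewrite !rmorph0 !mul0r !subr0 -surjective_pairing.
  - split=> // a u v [b Su] [b' Sv]; exists (a * b + b').
    have := Slin a _ _ Su Sv; congr S; congr pair; rewrite /=.
      by rewrite rmorphD rmorphM mulrDl opprD addrACA mulrBr mulrA.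
    by rewrite rmorphD rmorphM mulrDl opprD addrACA mulrBr mulrA.
  - by exists 1; rewrite !rmorph1 !mul1r !subrr.
have tot x : exists c, S (x, c).
  have [[m [m0 [c Smx]]]|nom] :=
      pselect (exists m, chi m != 0 /\ exists c, S (f m * x, c)).
    (* A multiple of [x] already has a value, which forces that of [x]. *)
    exists (c / chi m); apply: adj_max => u [a Su] Pu.
    have := SD _ _ (SZ m _ Su) (SZ a _ Smx) => /Ssep /=.
    rewrite mulrBr [f m * (f a * x)]mulrCA subrK => /(_ (PM _ _ Pu)).
    rewrite mulrBr [chi m * (chi a * _)]mulrCA [chi m * (c / _)]mulrC divfK //.
    by rewrite subrK => /eqP; rewrite mulf_eq0 (negPf m0) => /eqP.
  (* Otherwise the value at [x] is free; 0 is chosen. *)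
  exists 0; apply: adj_max => u [a]; rewrite mulr0 subr0 => Su Pu.
  have [a0|a0] := eqVneq (chi a) 0.
    apply: (Ssep _ Su) => /=; move/eqP: a0; rewrite chiP => Pa.
    by have := Plin (- x) _ _ Pa Pu; rewrite mulNr mulrC addrC.
  exfalso; apply: nom; exists a; split=> //; exists (- u.2).
  have := SD _ _ (SZ (-1) _ Su) (SP _ Pu); rewrite /= addr0 !rmorphN !rmorph1 !mulN1r.
  by rewrite opprB subrK.
have uniq x c c' : S (x, c) -> S (x, c') -> c = c'.
  move=> Sc Sc'; have /Ssep := Slin (-1) _ _ Sc Sc'.
  rewrite /= !rmorphN !rmorph1 !mulN1r addNr => /(_ P0) /eqP.
  by rewrite addrC subr_eq0 => /eqP.
exists (fun x => sval (cid (tot x))) => [|a b b'].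
  by case: cid => c /= Sc; apply: uniq Sc S1.
case: cid => c /= Sc; case: cid => e /= Se; case: cid => e' /= Se'.
exact: uniq Sc (Slin a _ _ Se Se').
Qed.

End LinearExtension.

Definition ring_alg (k S : comNzRingType) (f : {rmorphism k -> S}) : Type := S.

Section RingAlgebra.
Variables (k S : comNzRingType) (f : {rmorphism k -> S}).
Local Notation ring_alg := (ring_alg f).

HB.instance Definition _ := GRing.ComNzRing.on ring_alg.

Definition ring_alg_scale (c : k) (x : ring_alg) : ring_alg := f c * (x : S).

Lemma ring_alg_scaleA c e x :
  ring_alg_scale c (ring_alg_scale e x) = ring_alg_scale (c * e) x.
Proof. by rewrite /ring_alg_scale rmorphM mulrA. Qed.
Lemma ring_alg_scale1 : left_id 1 ring_alg_scale.
Proof. by move=> x; rewrite /ring_alg_scale rmorph1 mul1r. Qed.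
Lemma ring_alg_scaleDr : right_distributive ring_alg_scale +%R.
Proof. by move=> c x y; apply: mulrDr. Qed.
Lemma ring_alg_scaleDl x : {morph ring_alg_scale^~ x : c e / c + e}.
Proof. by move=> c e; rewrite /ring_alg_scale rmorphD mulrDl. Qed.

HB.instance Definition _ := GRing.Zmodule_isLmodule.Build k ring_alg
  ring_alg_scaleA ring_alg_scale1 ring_alg_scaleDr ring_alg_scaleDl.

Lemma ring_alg_scaleAl (c : k) (x y : ring_alg) : c *: (x * y) = (c *: x) * y.
Proof. exact: mulrA. Qed.

HB.instance Definition _ :=
  GRing.Lmodule_isLalgebra.Build k ring_alg ring_alg_scaleAl.
HB.instance Definition _ := GRing.Lalgebra_isComAlgebra.Build k ring_alg.

End RingAlgebra.

(** * Field-valued points *)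

Section AlgebraOfMorphism.
Variables (k : fieldType) (C : comAlgType k) (S : comNzRingType).
Variable g : {rmorphism C -> S}.

Definition scalar_morph : {rmorphism k -> S} := g \o in_alg C.

Definition to_ring_alg (a : C) : ring_alg scalar_morph := g a.

Lemma to_ring_alg_zmod : zmod_morphism to_ring_alg.
Proof. exact: (raddfB g). Qed.
Lemma to_ring_alg_monoid : monoid_morphism to_ring_alg.
Proof. by split; [apply: (rmorph1 g)|apply: (rmorphM g)]. Qed.
Lemma to_ring_alg_scalable : scalable to_ring_alg.
Proof. by move=> c a; rewrite -[a in LHS]mul1r scalerAl; apply: (rmorphM g). Qed.

HB.instance Definition _ := GRing.isZmodMorphism.Build C (ring_alg scalar_morph)
  to_ring_alg to_ring_alg_zmod.
HB.instance Definition _ := GRing.isMonoidMorphism.Build C (ring_alg scalar_morph)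
  to_ring_alg to_ring_alg_monoid.
HB.instance Definition _ := GRing.isScalable.Build k C (ring_alg scalar_morph) *:%R
  to_ring_alg to_ring_alg_scalable.

End AlgebraOfMorphism.

(* A linear functional r on B witnesses that B and L have a nonzero common
   quotient over A: the largest ideal of the tensor product on which
   b (x) c |-> r b * c vanishes is proper. *)
Lemma common_field (k : fieldType) (A B : comAlgType k) (f : {lrmorphism A -> B})
    (L : fieldType) (chi : {rmorphism A -> L}) (P : {pred B}) :
  idealr_closed P -> (forall a, (chi a == 0) = (f a \in P)) ->
  exists (M : fieldType) (e : {rmorphism L -> M}) (g : {rmorphism B -> M}),
    forall a, g (f a) = e (chi a).
Proof.
move=> P_ideal chiP; have [r r1 r_lin] := linear_extension P_ideal chiP.
have rD b b' : r (b + b') = r b + r b'.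
  by have := r_lin 1 b b'; rewrite !rmorph1 !mul1r.
have r0 : r 0 = 0 by apply: (addrI (r 0)); rewrite -rD !addr0.
have rM a b : r (f a * b) = chi a * r b.
  by have := r_lin a b 0; rewrite !addr0 r0 addr0.
have rZ c b : r (c *: b) = chi c%:A * r b.
  by rewrite -rM linearZ rmorph1 -scalerAl mul1r.
pose E : comAlgType k := ring_alg (scalar_morph chi).
pose rho : tens B E -> L := tens_lift (fun b (c : E) => r b * (c : L)).
have rho_bal : balanced (fun b (c : E) => r b * (c : L)).
  split=> [b b' c|b c c'|c b b'].
  - by rewrite rD mulrDl.
  - by rewrite mulrDr.
  - by rewrite rZ [_ * r b]mulrC -mulrA.
have rhoD t u : rho (t + u) = rho t + rho u by apply: tens_liftD.
have rho0 : rho 0 = 0 by apply: tens_lift0.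
have rhoN t : rho (- t) = - rho t.
  by apply: (addrI (rho t)); rewrite -rhoD !subrr.
have rhoP b c : rho (pure b c) = r b * c by apply: tens_lift_pure.
pose J : set (tens B E) := fun t => forall s, rho (s * t) = 0.
have [s|/(_ 1)|a u v Ju Jv s|M [h hJ]] := @ideal_field (tens B E) J.
- by rewrite mulr0.
- by rewrite mulr1 [1]/(pure 1 1) rhoP r1 mulr1 => /eqP; rewrite oner_eq0.
- by rewrite mulrDr mulrA rhoD Ju Jv addr0.
exists M, (h \o @tens_inr _ B E : {rmorphism E -> M}).
exists (h \o @tens_inl _ B E) => a /=.
(* The difference of [tens_inl (f a)] and [tens_inr (chi a)] lies in [J], since [r] is
   [A]-linear. *)
apply/eqP; rewrite -subr_eq0 -rmorphB; apply/eqP/hJ => s.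
elim/tens_ind: s => [|b c|s t IHs IHt]; first by rewrite mul0r.
  have e1 : rho (pure b c * tens_inl (f a)) = chi a * (r b * (c : L)).
    by rewrite [pure b c * _]pureM rhoP mulr1 [b * _]mulrC rM -mulrA.
  have e2 : rho (pure b c * tens_inr (chi a : E)) = chi a * (r b * (c : L)).
    rewrite [pure b c * _]pureM rhoP mulr1.
    by transitivity (r b * ((c : L) * chi a)); rewrite // mulrA mulrC.
  by rewrite mulrBr rhoD rhoN e1 e2 subrr.
by rewrite mulrDl rhoD IHs IHt addr0.
Qed.

Lemma nonzero_ring_field (C : comNzRingType) :
  exists L : fieldType, inhabited {rmorphism C -> L}.
Proof.
have [||a u v|L [f _]] := @ideal_field C [set 0]; last by exists L.
- by [].
- by move=> /eqP; rewrite oner_eq0.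
- by move=> -> ->; rewrite mulr0 addr0.
Qed.

Lemma ker_prime (C : comNzRingType) (L : fieldType) (f : {rmorphism C -> L}) :
  prime_ideal (fun a => f a == 0).
Proof.
split; first split; rewrite ?unfold_in ?rmorph0 ?rmorph1 ?oner_eq0 //.
  move=> a u v; rewrite !unfold_in rmorphD rmorphM => /eqP -> /eqP ->.
  by rewrite mulr0 addr0.
by move=> u v; rewrite !unfold_in rmorphM mulf_eq0.
Qed.

Section FieldPoint.
Variables (F : diffFieldType) (charF : [pchar F] =i pred0).
Variables (G G' : linAlgGroup (constants F)).
Variables (phi : groupMorphism G G') (X : torsor G) (X' : torsor G').
Variables (psi : {lrmorphism tcoord X' -> tcoord X}).
Hypotheses (psi_eqv : equivariant phi psi) (phi_surj : surjective_morphism phi).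

(** Over F[X] (x) L, some [g'] in G' moves the image of the universal point of [X] to [y]. At a
    field-valued point of this ring, surjectivity of [phi] and [common_field] lift [g'] to a point
    [g] of G over a larger field; translating by [g] gives a point of [X] above [y]. *)
Lemma surjective_on_field_points (L : fieldType) (y : {rmorphism tcoord X' -> L}) :
  exists (M : fieldType) (s : {rmorphism F -> M}) (e : {rmorphism L -> M})
    (x : tpoint X (ring_alg s)), forall b, x (psi b) = e (y b).
Proof.
pose E : comAlgType F := ring_alg (scalar_morph y).
pose C := tens (tcoord X) E.
pose x1 : tpoint X C := tens_inl.
pose y1 : tpoint X' C := tens_inr \o to_ring_alg y.
have [g' [y1E _]] := tact_simply_transitive (x1 \o psi : tpoint X' C) y1.
have [L2 [m]] := nonzero_ring_field C.
pose chi : {rmorphism gcoord G' -> L2} := m \o g'.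
have [P [P_ideal _] chiP] := phi_surj (ker_prime chi).
have [M [e [g gE]]] := common_field P_ideal chiP.
pose em : {rmorphism C -> M} := e \o m.
pose R : comAlgType F := ring_alg (scalar_morph em).
(* [g] is so far a ring morphism only; it is linear over the constants because [g'] is, scalars
   coming from K[G'] through [phi]. *)
have g_scal : scalable (g : gcoord G -> restr R).
  move=> c a; rewrite -[a in LHS]mul1r scalerAl -[1](rmorph1 phi) -linearZ.
  transitivity (g (phi (c *: 1)) * g a); first exact: rmorphM.
  have gc : g' (c *: 1) = c *: 1 :> restr C by rewrite linearZ rmorph1.
  by rewrite gE /= gc.
pose gR : gpoint G (restr R) := HB.pack (g : gcoord G -> restr R)
  (GRing.isScalable.Build _ (gcoord G) (restr R) *:%R g g_scal) g.
exists M, (scalar_morph em), (em \o @tens_inr _ (tcoord X) E : {rmorphism E -> M}).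
exists (tact (to_ring_alg em \o x1 : tpoint X R) gR) => b.
rewrite [LHS](psi_eqv (to_ring_alg em \o x1) gR).
transitivity (to_ring_alg em (y1 b)) => //.
rewrite y1E tact_map; exact: eq_tact.
Qed.

Lemma differential_field_point (d' : tcoord X' -> tcoord X') :
  differential_structure d' ->
  exists (R : comAlgType F) (x : tpoint X (dual R)),
    forall b, (x (psi b)).2 = (x (psi (d' b))).1.
Proof.
move=> [[d'D d'M] d'F _]; have char_ext (L : fieldType) (s : {rmorphism F -> L}) :
    [pchar L] =i pred0 by move=> p; rewrite (fmorph_pchar s) charF.
have [L0 [y0]] := nonzero_ring_field (tcoord X').
(* Passing from [y0] to [y] makes the kernel stable under [d']. *)
have [L [y yQ]] := prime_ideal_field
  (iter_ideal_prime y0 (conj d'D d'M) (char_ext _ (scalar_morph y0))).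
have [M [s [e [x xE]]]] := surjective_on_field_points y.
(* The graph of the derivation that [d'] induces on the image of F[X'] in [M]; it is single-valued
   because the kernel of [y] is stable. *)
pose S0 : set (dual_numbers M) := fun z => exists b, z = (x (psi b), x (psi (d' b))).
have d'B u v : d' (u - v) = d' u - d' v.
  by apply: (addIr (d' v)); rewrite -d'D !subrK.
have d'1 : d' 1 = 0 by have := d'F 1; rewrite der1 scale1r scale0r.
have [||D [DD DM] DE] := @derivation_extension M S0 (char_ext _ s).
- split=> [|_ _ [u ->] [v ->]|_ _ [u ->] [v ->]].
  + by exists 1; rewrite d'1 !rmorph1 !rmorph0.
  + by exists (u - v); rewrite d'B !rmorphB.
  + exists (u * v); congr pair; first by rewrite /= !rmorphM.
    by rewrite d'M rmorphD /= rmorphD !rmorphM addrC.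
- move=> _ [b ->] /= xb0; congr pair => //.
  have : y b == 0 by rewrite -(fmorph_eq0 e) -xE xb0.
  rewrite yQ => /iter_ideal_stable; rewrite -yQ => /eqP yd'b.
  by rewrite xE yd'b rmorph0.
have x_der : derivation_over x (D \o x).
  split=> [a b|a b|c] /=; first by rewrite rmorphD DD.
    by rewrite rmorphM DM.
  (* Scalars of [F] come from F[X'], so [D] extends [der]. *)
  have := DE (x (psi c%:A), x (psi (d' c%:A))).
  rewrite d'F !linearZ /= !rmorph1; apply.
  by exists c%:A; rewrite d'F !linearZ /= !rmorph1.
exists (ring_alg s), (dual_point x_der) => b.
exact: (DE (x (psi b), x (psi (d' b))) (ex_intro _ b erefl)).
Qed.

End FieldPoint.

Theorem proposition1p8 (F : diffFieldType) (charF0 : [pchar F] =i pred0)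
    (G G' : linAlgGroup (constants F)) (phi : groupMorphism G G')
    (X : torsor G) (X' : torsor G')
    (psi : {lrmorphism tcoord X' -> tcoord X})
    (psi_equivariant : equivariant phi psi) :
  (forall d : tcoord X -> tcoord X, differential_structure d ->
     exists! d' : tcoord X' -> tcoord X',
       differential_structure d' /\ differential_morphism psi d d') /\
  (forall d' : tcoord X' -> tcoord X', differential_structure d' ->
     GRing.closed_field_axiom (constants F) ->
     surjective_morphism phi ->
     exists d : tcoord X -> tcoord X,
       differential_structure d /\ differential_morphism psi d d').
Proof.
split=> [d hd|d' hd' _ phi_surj].
  have [d' hd' psi_d'] := pushforward_exists psi_equivariant hd.
  exists d'; split=> // d1 [hd1 psi_d1]; apply/funext.
  exact: pushforward_unique hd' psi_d' hd1 psi_d1.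
have [R [x xE]] := differential_field_point charF0 psi_equivariant phi_surj hd'.
by have [d hd psi_d] := pullback_exists psi_equivariant hd' xE; exists d.
Qed.
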